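(* There exists an algorithm which takes as input any vector space HBL datum $(V,(V_j),(\phi_j))$ over the rationals, i.e. with $\mathbb{F}=\mathbb{Q}$, and returns as output both a list of finitely many linear inequalities over $\mathbb{Z}$ which jointly specify the associated polytope $\mathcal{P}(V,(V_j),(\phi_j))$, and a list of all extreme points of $\mathcal{P}(V,(V_j),(\phi_j))$.
   Context: A vector space HBL datum over a field $\mathbb{F}$ is a 3-tuple $(V,(V_1,\ldots,V_m),(\phi_1,\ldots,\phi_m))$, abbreviated $(V,(V_j),(\phi_j))$, where $V$ and $V_1,\ldots,V_m$ are finite-dimensional vector spaces over $\mathbb{F}$ and each $\phi_j\colon V\to V_j$ is $\mathbb{F}$-linear. Its associated polytope $\mathcal{P}(V,(V_j),(\phi_j))$ is the set of all $s\in[0,1]^m$ such that $\dim(W)\le\sum_{j=1}^m s_j\dim(\phi_j(W))$ for all subspaces $W\le V$. *)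

(* Defs.v *)
From HB Require Import structures.
From mathcomp Require Import all_boot all_order all_algebra.
From mathcomp Require Import boolp classical_sets reals.

Set Implicit Arguments.
Unset Strict Implicit.
Unset Printing Implicit Defensive.

Import Order.TTheory GRing.Theory Num.Theory.

(* Algorithms are Kleene's partial recursive functions. Terms carry no arity:
   arguments are read from a list, and missing arguments are read as 0, so on
   lists of any fixed length the terms denote exactly the partial recursive
   functions of that arity. *)
Inductive recfun : Type :=
  | RZero
  | RSucc
  | RProj of nat
  | RComp of recfun & seq recfun
  | RPrec of recfun & recfun
  | RMu of recfun.

(* receval e v y : the evaluation of e on the arguments v halts with value y.
   - RPrec f g is h with h(0, v) = f(v) and h(k + 1, v) = g(k, h(k, v), v);
   - RMu f maps v to the least y with f(y, v) = 0, and requires f(k, v) to be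
     defined (and nonzero) for all k < y. *)
Fixpoint receval (e : recfun) (v : seq nat) (y : nat) {struct e} : Prop :=
  match e with
  | RZero => y = 0
  | RSucc => y = (nth 0 v 0).+1
  | RProj i => y = nth 0 v i
  | RComp f gs =>
      exists2 w : seq nat,
        (fix evals (gs : seq recfun) (w : seq nat) {struct gs} : Prop :=
           match gs, w with
           | [::], [::] => True
           | g :: gs', z :: w' => receval g v z /\ evals gs' w'
           | _, _ => False
           end) gs w
        & receval f w y
  | RPrec f g =>
      (fix iterates (k y : nat) {struct k} : Prop :=
         match k with
         | 0 => receval f (behead v) y
         | k'.+1 =>
             exists2 z, iterates k' z & receval g [:: k', z & behead v] y
         end) (head 0 v) y
  | RMu f =>
      receval f (y :: v) 0
      /\ forall k, k < y -> exists z, receval f (k :: v) z.+1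
  end.

Fixpoint receval_functional (e : recfun) {struct e} :
  forall v y y', receval e v y -> receval e v y' -> y = y'.
Proof.
case: e => [||i|f gs|f g|f] v y y' /=.
- by move=> -> ->.
- by move=> -> ->.
- by move=> -> ->.
- case=> w ew fw [w' ew' fw']; suff ww' : w = w'.
    by rewrite -ww' in fw'; exact: (receval_functional f w).
  elim: gs w w' ew ew' {fw fw'} => [|g gs IH] [|z w] [|z' w'] //=.
  case=> gz ew [gz' ew']; rewrite (IH _ _ ew ew').
  by rewrite (receval_functional g _ _ _ gz gz').
- elim: (head 0 v) y y' => [|k IH] y y' /=.
    exact: (receval_functional f).
  case=> z ez gz [z' ez' gz']; rewrite -(IH _ _ ez ez') in gz'.
  exact: (receval_functional g) gz gz'.
- move=> [fy lty] [fy' lty']; case: (ltngtP y y') => // yy'.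
    by have [z fz] := lty' _ yy'; have := receval_functional f _ _ _ fy fz.
  by have [z fz] := lty _ yy'; have := receval_functional f _ _ _ fy' fz.
Qed.

(* Finitary data are represented by their codes under pickle, which is an
   explicit effective coding for nat, int, rat, pairs, sequences and tuples. *)
Definition computes (A B : countType) (e : recfun) (a : A) (b : B) : Prop :=
  receval e [:: pickle a] (pickle b).

Local Open Scope ring_scope.
Local Open Scope classical_set_scope.

Record hbl_datum (F : fieldType) := HBLDatum {
  hbl_m : nat;
  hbl_V : vectType F;
  hbl_Vj : 'I_hbl_m -> vectType F;
  hbl_phi : forall j : 'I_hbl_m, 'Hom(hbl_V, hbl_Vj j)
}.
Arguments hbl_Vj {F} D j : rename.
Arguments hbl_phi {F} D j : rename.

Definition hbl_polytope (R : realType) (F : fieldType) (D : hbl_datum F) :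
    set 'rV[R]_(hbl_m D) :=
  [set s : 'rV[R]_(hbl_m D) | (forall j, 0 <= s 0 j <= 1) /\
      forall W : {vspace hbl_V D},
        (\dim W)%:R <=
          \sum_(j < hbl_m D) s 0 j * (\dim (hbl_phi D j @: W)%VS)%:R].
Arguments hbl_polytope R {F} D.

Definition extreme_point (R : numDomainType) (E : lmodType R) (P : set E)
    (s : E) : Prop :=
  P s /\ forall (x y : E) (t : R), P x -> P y -> 0 < t < 1 ->
    s = t *: x + (1 - t) *: y -> x = y.

(* (a, b) stands for the inequality a_1 s_1 + ... + a_m s_m <= b. *)
Definition ineqs_solutions (R : realType) (m : nat)
    (L : seq (m.-tuple int * int)) : set 'rV[R]_m :=
  [set s : 'rV[R]_m | forall ab, ab \in L ->
             \sum_(j < m) (tnth ab.1 j)%:~R * s 0 j <= ab.2%:~R].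
Arguments ineqs_solutions R {m} L.

Definition rat_point (R : realType) (m : nat) (q : m.-tuple rat) : 'rV[R]_m :=
  \row_j ratr (tnth q j).
Arguments rat_point R {m} q.

(* An input is dim V together with, for each j, dim V_j and the list of the
   rows of a matrix of phi_j. *)
Definition hbl_input : Type := (nat * seq (nat * seq (seq rat)))%type.

Definition hbl_output (m : nat) : Type :=
  (seq (m.-tuple int * int) * seq (m.-tuple rat))%type.

Definition mx_rows (p q : nat) (A : 'M[rat]_(p, q)) : seq (seq rat) :=
  [seq [seq A i k | k <- enum 'I_q] | i <- enum 'I_p].

(* Since mxof acts on row vectors, the i-th row listed for phi_j gives the
   coordinates in the basis Y j of the image of the i-th vector of X. *)
Definition hbl_presentation (D : hbl_datum rat)
    (X : (\dim {:hbl_V D}).-tuple (hbl_V D))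
    (Y : forall j, (\dim {:hbl_Vj D j}).-tuple (hbl_Vj D j)) : hbl_input :=
  (\dim {:hbl_V D},
   [seq (\dim {:hbl_Vj D j}, mx_rows (passmx.mxof X (Y j) (hbl_phi D j)))
      | j <- enum 'I_(hbl_m D)]).

(* Main.v *)
Require Import Defs.
From HB Require Import structures.
From mathcomp Require Import all_boot all_order all_algebra all_fingroup.
From mathcomp Require Import boolp classical_sets reals.
From mathcomp Require Import zify ring lra.

(* Whether a rational point s lies in the polytope is semi-decidable both
   ways. A point outside violates the inequality of some subspace W. A point
   s = p/q inside is certified by matrices A_j of size k p_j x k q such that
   X |-> (A_j X phi_j)_j is injective on the k q x n matrices: applied to the
   X with rows in W, injectivity yields q dim W <= sum_j p_j dim phi_j(W). Such
   certificates always exist. They exist for convex combinations (block-diagonal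
   matrices), so vertices suffice; if W is a proper tight subspace for s, then s
   lies in the polytopes of W and of V/W, and a generic combination of the
   certificates of these smaller data is a certificate for V; at a vertex without
   proper tight subspaces at most one coordinate is not 0 or 1, and identity
   matrices work.

   By Cramer's rule the vertices lie in an explicit finite grid. A single unbounded
   search decides membership for all grid points. The polytope is the convex hull
   of the grid points that it contains, it is cut out by the finitely many
   inequalities with small coefficients that hold at these, and a grid point is
   extreme when no other one satisfies all the inequalities tight at it. *)

Set Implicit Arguments.
Unset Strict Implicit.
Unset Printing Implicit Defensive.

Import Order.TTheory GRing.Theory Num.Theory.

(** * Recursive functions *)

(** Only finitely many inequalities define the polytope, since each depends only on the ranks of [W]
    and its images. To list them, however, one would have to decide which rank vectors are realized
    by rational subspaces, a question about rational solutions of polynomial equations for which no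
    algorithm is known. Membership of a single rational point avoids this: both answers have finite
    witnesses, so the search needs no bound on their size. The inequalities of the output need not
    come from subspaces; those that do are among them. Certificates are stated for intervals
    [K <= V] of subspaces, so that passing to a subspace or a quotient changes neither the matrices
    [phi] nor their sizes. Two certificates are combined on the line that joins them: each property
    is a lower bound on the rank of a matrix affine in the parameter, hence fails for finitely many
    parameters only. Certificates are rational while the polytope is real; at a grid point the
    defining inequalities, multiplied by the denominator, compare natural numbers and do not depend
    on the field. *)

Definition recursive k (f : seq nat -> nat) : Prop :=
  exists e, forall v, size v = k -> receval e v (f v).

Definition decidable_rec k (P : seq nat -> bool) : Prop :=
  recursive k (fun v => nat_of_bool (P v)).

Lemma recursive_ext k f g :
  recursive k f -> (forall v, size v = k -> f v = g v) -> recursive k g.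
Proof. by case=> e fe fg; exists e => v sv; rewrite -fg //; exact: fe. Qed.

Lemma receval_comp e gs v w y :
  size gs = size w ->
  (forall i, i < size gs -> receval (nth RZero gs i) v (nth 0 w i)) ->
  receval e w y -> receval (RComp e gs) v y.
Proof.
move=> sgs gsw ey /=; exists w => //.
elim: gs w sgs gsw {ey} => [|g gs IH] [|z w] //= [sgs] gsw.
by split; [exact: (gsw 0) | apply: IH => // i; exact: (gsw i.+1)].
Qed.

Lemma recursive_var k i : recursive k (fun v => nth 0 v i).
Proof. by exists (RProj i). Qed.

Lemma recursive_comp1 k f g :
  recursive 1 (fun w => f (nth 0 w 0)) -> recursive k g ->
  recursive k (fun v => f (g v)).
Proof.
case=> e fe [e' ge]; exists (RComp e [:: e']) => v sv.
apply: (receval_comp (w := [:: g v])) => //; last exact: fe.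
by case=> //= _; exact: ge.
Qed.

Lemma recursive_comp2 k f g h :
  recursive 2 (fun w => f (nth 0 w 0) (nth 0 w 1)) ->
  recursive k g -> recursive k h -> recursive k (fun v => f (g v) (h v)).
Proof.
case=> e fe [eg ge] [eh he]; exists (RComp e [:: eg; eh]) => v sv.
apply: (receval_comp (w := [:: g v; h v])) => //; last exact: fe.
by case=> [|[]] //= _; [exact: ge | exact: he].
Qed.

Lemma recursive_succ k f : recursive k f -> recursive k (fun v => (f v).+1).
Proof. by apply: recursive_comp1; exists RSucc. Qed.

Lemma recursive_const k n : recursive k (fun _ => n).
Proof. by elim: n => [|n /recursive_succ //]; exists RZero. Qed.

(** Bound variables are pushed in front of the argument list, in de Bruijn style; projections pass
    the old arguments on. *)
Lemma recursive_let k (F : nat -> seq nat -> nat) b :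
  recursive k.+1 (fun w => F (head 0 w) (behead w)) -> recursive k b ->
  recursive k (fun v => F (b v) v).
Proof.
case=> e Fe [e' be]; exists (RComp e (e' :: map RProj (iota 0 k))) => v sv.
apply: (receval_comp (w := b v :: v)); first by rewrite /= size_map size_iota sv.
- case=> [|i] /=; first by move=> _; exact: be.
  rewrite size_map size_iota ltnS => ik.
  by rewrite (nth_map 0) ?size_iota //= nth_iota.
- by apply: Fe; rewrite /= sv.
Qed.

Lemma recursive_iteri k (g : nat -> nat -> seq nat -> nat) a b :
  recursive k.+2 (fun w => g (head 0 w) (head 0 (behead w)) (behead (behead w))) ->
  recursive k a -> recursive k b ->
  recursive k (fun v => iteri (b v) (fun i z => g i z v) (a v)).
Proof.
case=> eg ge [ea ae]; pose F i v := iteri i (fun i z => g i z v) (a v).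
apply: (recursive_let (F := F)); exists (RPrec ea eg) => v sv /=.
have sv' : size (behead v) = k by rewrite size_behead sv.
elim: (head 0 v) => [|i IH] /=; first exact: ae.
by exists (F i (behead v)) => //; apply: ge; rewrite /= sv'.
Qed.

(** Under binders a variable appears as a nest of [head] and [behead]; [rec_var] rewrites it to an
    [nth], from which unification reads off the index. *)
Lemma recursive_varE k i f : (forall v, f v = nth 0 v i) -> recursive k f.
Proof. by move=> fE; exists (RProj i) => v _; rewrite fE. Qed.

Ltac rec_var :=
  eapply recursive_varE; intro;
  rewrite -?nth0 ?nth_behead; reflexivity.

Lemma recursive_add k f g :
  recursive k f -> recursive k g -> recursive k (fun v => f v + g v).
Proof.
move=> rf rg; have /= := recursive_iteri (g := fun _ z _ => z.+1) _ rf rg.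
move=> H; apply: recursive_ext; first apply: H.
- by apply: recursive_succ; rec_var.
- by move=> v _ /=; elim: (g v) => /= [|n ->]; rewrite ?addn0 ?addnS.
Qed.

Lemma recursive_mul k f g :
  recursive k f -> recursive k g -> recursive k (fun v => f v * g v).
Proof.
move=> rf rg.
have /= H := recursive_iteri (g := fun _ z v => f v + z) _ (recursive_const k 0) rg.
apply: recursive_ext; first apply: H.
- apply: recursive_add; last rec_var.
  case: rf => e fe; exists (RComp e (map RProj (iota 2 k))) => v sv.
  have sb : size (behead (behead v)) = k by rewrite !size_behead sv.
  apply: (receval_comp (w := behead (behead v))).
  + by rewrite size_map size_iota.
  + move=> i; rewrite size_map size_iota => ik.
    by rewrite (nth_map 0) ?size_iota //= nth_iota // !nth_behead.
  + exact: fe.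
- move=> v _ /=; elim: (g v) => /= [|n ->]; first by rewrite muln0.
  by rewrite mulnS.
Qed.

Lemma recursive_pred k f : recursive k f -> recursive k (fun v => (f v).-1).
Proof.
move=> rf; apply: (recursive_comp1 (f := predn) _ rf).
have /= := recursive_iteri (g := fun i _ _ => i) (k := 1) (b := fun w => nth 0 w 0) _
  (recursive_const 1 0) (recursive_var 1 0).
move=> H; apply: recursive_ext; first by apply: H; rec_var.
by move=> v _ /=; case: (nth 0 v 0).
Qed.

Lemma recursive_sub k f g :
  recursive k f -> recursive k g -> recursive k (fun v => f v - g v).
Proof.
move=> rf rg; have /= := recursive_iteri (g := fun _ z _ => z.-1) _ rf rg.
move=> H; apply: recursive_ext; first apply: H.
- by apply: recursive_pred; rec_var.
- by move=> v _ /=; elim: (g v) => /= [|n ->]; rewrite ?subn0 ?subnS.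
Qed.

(** With truncated subtraction, the truth value of [f <= g] is [1 - (f - g)]. *)
Lemma decidable_rec_leq k f g :
  recursive k f -> recursive k g -> decidable_rec k (fun v => f v <= g v).
Proof.
move=> rf rg; apply: recursive_ext.
  exact: (recursive_sub (recursive_const k 1) (recursive_sub rf rg)).
by move=> v _ /=; rewrite /leq; case: (f v - g v) => [|[]].
Qed.

Lemma decidable_rec_and k P Q :
  decidable_rec k P -> decidable_rec k Q -> decidable_rec k (fun v => P v && Q v).
Proof.
move=> rP rQ; apply: recursive_ext; first exact: (recursive_mul rP rQ).
by move=> v _ /=; rewrite mulnb.
Qed.

Lemma decidable_rec_neg k P : decidable_rec k P -> decidable_rec k (fun v => ~~ P v).
Proof.
move=> rP; apply: recursive_ext.
  exact: (recursive_sub (recursive_const k 1) rP).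
by move=> v _ /=; case: (P v).
Qed.

Lemma decidable_rec_or k P Q :
  decidable_rec k P -> decidable_rec k Q -> decidable_rec k (fun v => P v || Q v).
Proof.
move=> rP rQ; apply: recursive_ext.
  exact: decidable_rec_neg (decidable_rec_and (decidable_rec_neg rP) (decidable_rec_neg rQ)).
by move=> v _ /=; case: (P v); case: (Q v).
Qed.

Lemma decidable_rec_imply k P Q :
  decidable_rec k P -> decidable_rec k Q -> decidable_rec k (fun v => P v ==> Q v).
Proof.
move=> rP rQ; apply: recursive_ext.
  exact: decidable_rec_or (decidable_rec_neg rP) rQ.
by move=> v _ /=; rewrite implybE.
Qed.

Lemma decidable_rec_eq k f g :
  recursive k f -> recursive k g -> decidable_rec k (fun v => f v == g v).
Proof.
move=> rf rg; apply: recursive_ext.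
  exact: decidable_rec_and (decidable_rec_leq rf rg) (decidable_rec_leq rg rf).
by move=> v _ /=; rewrite -eqn_leq.
Qed.

Lemma recursive_if k P f g :
  decidable_rec k P -> recursive k f -> recursive k g ->
  recursive k (fun v => if P v then f v else g v).
Proof.
move=> rP rf rg; apply: recursive_ext.
  exact: recursive_add (recursive_mul rP rf) (recursive_mul (decidable_rec_neg rP) rg).
by move=> v _ /=; case: (P v); rewrite !(mul1n, mul0n, addn0).
Qed.

(* The bound variable of these operators is a natural number rather than an
   ordinal, so that their bodies can be matched by higher-order patterns. *)
Definition sum_below n (F : nat -> nat) := \sum_(i < n) F i.
Definition prod_below n (F : nat -> nat) := \prod_(i < n) F i.
Definition all_below n (P : pred nat) := all P (iota 0 n).
Definition has_below n (P : pred nat) := has P (iota 0 n).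

Lemma all_belowP n (P : pred nat) :
  reflect (forall i, i < n -> P i) (all_below n P).
Proof.
apply: (iffP allP) => H i; first by move=> lin; apply: H; rewrite mem_iota.
by rewrite mem_iota => /andP[_]; exact: H.
Qed.

Lemma has_belowP n (P : pred nat) :
  reflect (exists2 i, i < n & P i) (has_below n P).
Proof.
apply: (iffP hasP) => -[i Hi Pi]; exists i => //; last by rewrite mem_iota.
by move: Hi; rewrite mem_iota.
Qed.

(** The body of an iteration receives the counter and the accumulator; this serves bodies that read
    the counter only. *)
Lemma recursive_weaken2 k (F : nat -> seq nat -> nat) :
  recursive k.+1 (fun w => F (head 0 w) (behead w)) ->
  recursive k.+2 (fun w => F (head 0 w) (behead (behead w))).
Proof.
case=> e Fe; exists (RComp e (map RProj (0 :: iota 2 k))) => v sv.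
have sb : size (behead (behead v)) = k by rewrite !size_behead sv.
apply: (receval_comp (w := head 0 v :: behead (behead v))).
- by rewrite /= size_map size_iota sb.
- case=> [_ | i]; rewrite /= ?nth0 // size_map size_iota ltnS => ik.
  by rewrite (nth_map 0) ?size_iota //= nth_iota // !nth_behead.
- by apply: Fe; rewrite /= sb.
Qed.

Lemma recursive_sum k (F : nat -> seq nat -> nat) b :
  recursive k b -> recursive k.+1 (fun w => F (head 0 w) (behead w)) ->
  recursive k (fun v => sum_below (b v) (fun i => F i v)).
Proof.
move=> rb rF.
have /= H := recursive_iteri (g := fun i z v => z + F i v) _ (recursive_const k 0) rb.
apply: recursive_ext.
  apply: H; apply: recursive_add; first by rec_var.
  exact: recursive_weaken2.
move=> v _ /=; rewrite /sum_below /=; elim: (b v) => /= [|n IH]; first by rewrite big_ord0.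
by rewrite big_ord_recr /= IH.
Qed.

Lemma recursive_prod k (F : nat -> seq nat -> nat) b :
  recursive k b -> recursive k.+1 (fun w => F (head 0 w) (behead w)) ->
  recursive k (fun v => prod_below (b v) (fun i => F i v)).
Proof.
move=> rb rF.
have /= H := recursive_iteri (g := fun i z v => z * F i v) _ (recursive_const k 1) rb.
apply: recursive_ext.
  apply: H; apply: recursive_mul; first by rec_var.
  exact: recursive_weaken2.
move=> v _ /=; rewrite /prod_below /=; elim: (b v) => /= [|n IH]; first by rewrite big_ord0.
by rewrite big_ord_recr /= IH.
Qed.

Lemma decidable_rec_all k (P : nat -> seq nat -> bool) b :
  recursive k b -> decidable_rec k.+1 (fun w => P (head 0 w) (behead w)) ->
  decidable_rec k (fun v => all_below (b v) (fun i => P i v)).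
Proof.
move=> rb rP; apply: recursive_ext.
  exact: (recursive_prod (F := fun i v => P i v) rb rP).
move=> v _ /=; rewrite /prod_below /all_below /=; elim: (b v) => [|n IH].
  by rewrite big_ord0.
have -> : iota 0 n.+1 = rcons (iota 0 n) n by rewrite -addn1 iotaD cats1.
by rewrite big_ord_recr IH all_rcons /= mulnC mulnb.
Qed.

Lemma decidable_rec_has k (P : nat -> seq nat -> bool) b :
  recursive k b -> decidable_rec k.+1 (fun w => P (head 0 w) (behead w)) ->
  decidable_rec k (fun v => has_below (b v) (fun i => P i v)).
Proof.
move=> rb /decidable_rec_neg rP.
have := decidable_rec_neg (decidable_rec_all (P := fun i v => ~~ P i v) rb rP).
move=> /recursive_ext; apply => v _; rewrite /all_below /has_below.
by rewrite all_predC negbK.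
Qed.

Lemma recursive_exp k f g :
  recursive k f -> recursive k g -> recursive k (fun v => f v ^ g v).
Proof.
apply: recursive_comp2.
have H := recursive_prod (k := 2) (F := fun _ v => nth 0 v 0) (b := fun w => nth 0 w 1).
apply: recursive_ext; first by apply: H; rec_var.
by move=> v _ /=; rewrite /prod_below prod_nat_const card_ord.
Qed.

Lemma recursive_fact k f : recursive k f -> recursive k (fun v => (f v)`!).
Proof.
apply: recursive_comp1.
have H := recursive_prod (k := 1) (F := fun i v => i.+1) (b := fun w => nth 0 w 0).
apply: recursive_ext.
  by apply: H; [rec_var | apply: recursive_succ; rec_var].
move=> v _ /=; rewrite /prod_below /=; elim: (nth 0 v 0) => [|n IH]; first by rewrite big_ord0.
by rewrite big_ord_recr IH /= factS mulnC.
Qed.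

Lemma sum_belowE n m : sum_below n (fun i => i < m) = minn n m.
Proof.
rewrite /sum_below; elim: n => [|n IH]; first by rewrite big_ord0 min0n.
rewrite big_ord_recr /= IH; case: ltnP => lt.
  by rewrite (minn_idPl lt) addn1.
by rewrite (minn_idPr (leqW lt)) addn0.
Qed.

(** For positive [d] the condition on [i] means [i < m %/ d], so the sum counts up to the
    quotient. *)
Lemma divn_sum m d : m %/ d = if d == 0 then 0 else sum_below m (fun i => i.+1 * d <= m).
Proof.
have [->|d0] := eqVneq d 0; first by rewrite divn0.
rewrite /sum_below -lt0n in d0 *.
rewrite (eq_bigr (fun i : 'I_m => nat_of_bool (i < m %/ d))); last first.
  by move=> i _; rewrite leq_divRL.
by rewrite -/(sum_below m (fun i => i < m %/ d)) sum_belowE (minn_idPr _) ?leq_div.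
Qed.

Lemma recursive_div k f g :
  recursive k f -> recursive k g -> recursive k (fun v => f v %/ g v).
Proof.
apply: recursive_comp2; apply: recursive_ext; last first.
  by move=> v _ /=; exact/esym/divn_sum.
apply: recursive_if; [|exact: recursive_const|].
  by apply: decidable_rec_eq; [rec_var | exact: recursive_const].
apply: (recursive_sum (F := fun i v => i.+1 * nth 0 v 1 <= nth 0 v 0)); first by rec_var.
apply: decidable_rec_leq; last by rec_var.
by apply: recursive_mul; [apply: recursive_succ|]; rec_var.
Qed.

Lemma recursive_mod k f g :
  recursive k f -> recursive k g -> recursive k (fun v => f v %% g v).
Proof.
move=> rf rg; apply: recursive_ext.
  exact: (recursive_sub rf (recursive_mul (recursive_div rf rg) rg)).
by move=> v _ /=; rewrite {1}(divn_eq (f v) (g v)) addKn.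
Qed.

(** * Rational-valued recursive functions *)

(** Fractions are not reduced and signs are differences of naturals, so arithmetic uses only sums
    and products. *)
Definition rat_recursive k (q : seq nat -> rat) : Prop :=
  exists f g h, [/\ recursive k f, recursive k g, recursive k h &
    forall v, size v = k ->
      0 < h v /\ q v = (((f v)%:R - (g v)%:R) / (h v)%:R)%R].

Lemma rat_recursive_nat k f : recursive k f -> rat_recursive k (fun v => (f v)%:R%R).
Proof.
move=> rf; exists f, (fun=> 0), (fun=> 1); split => //; try exact: recursive_const.
by move=> v _; rewrite subr0 divr1.
Qed.

Lemma rat_recursive_const0 k : rat_recursive k (fun=> 0%R).
Proof. exact: (rat_recursive_nat (recursive_const k 0)). Qed.

Lemma rat_recursive_add k p q : rat_recursive k p -> rat_recursive k q ->
  rat_recursive k (fun v => (p v + q v)%R).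
Proof.
move=> [f [g [h [rf rg rh E]]]] [f' [g' [h' [rf' rg' rh' E']]]].
exists (fun v => f v * h' v + f' v * h v), (fun v => g v * h' v + g' v * h v).
exists (fun v => h v * h' v); split.
- by apply: recursive_add; apply: recursive_mul.
- by apply: recursive_add; apply: recursive_mul.
- exact: recursive_mul.
move=> v sv; have [h0 ->] := E v sv; have [h0' ->] := E' v sv.
split; first by rewrite muln_gt0 h0.
by rewrite !natrD !natrM; field; rewrite !pnatr_eq0 -!lt0n h0 h0'.
Qed.

Lemma rat_recursive_opp k p : rat_recursive k p -> rat_recursive k (fun v => (- p v)%R).
Proof.
move=> [f [g [h [rf rg rh E]]]]; exists g, f, h; split => // v sv.
by have [h0 ->] := E v sv; split=> //; rewrite -mulNr opprB.
Qed.

Lemma rat_recursive_sub k p q : rat_recursive k p -> rat_recursive k q ->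
  rat_recursive k (fun v => (p v - q v)%R).
Proof. by move=> rp rq; apply: rat_recursive_add => //; apply: rat_recursive_opp. Qed.

Lemma rat_recursive_mul k p q : rat_recursive k p -> rat_recursive k q ->
  rat_recursive k (fun v => (p v * q v)%R).
Proof.
move=> [f [g [h [rf rg rh E]]]] [f' [g' [h' [rf' rg' rh' E']]]].
exists (fun v => f v * f' v + g v * g' v), (fun v => f v * g' v + g v * f' v).
exists (fun v => h v * h' v); split.
- by apply: recursive_add; apply: recursive_mul.
- by apply: recursive_add; apply: recursive_mul.
- exact: recursive_mul.
move=> v sv; have [h0 ->] := E v sv; have [h0' ->] := E' v sv.
split; first by rewrite muln_gt0 h0.
by rewrite !natrD !natrM; field; rewrite !pnatr_eq0 -!lt0n h0 h0'.
Qed.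

(** Division by 0 yields 0: in that case the numerators are multiplied by 0 and the denominator by
    1. *)
Lemma rat_recursive_divn k p d : rat_recursive k p -> recursive k d ->
  rat_recursive k (fun v => (p v / (d v)%:R)%R).
Proof.
move=> [f [g [h [rf rg rh E]]]] rd.
have rd0 : decidable_rec k (fun v => 0 < d v).
  exact: decidable_rec_leq (recursive_const k 1) rd.
exists (fun v => f v * (0 < d v)), (fun v => g v * (0 < d v)).
exists (fun v => h v * (if 0 < d v then d v else 1)); split.
- exact: recursive_mul.
- exact: recursive_mul.
- by apply: recursive_mul => //; apply: recursive_if => //; exact: recursive_const.
move=> v sv; have [h0 ->] := E v sv; have [d0|d0] : d v = 0 \/ 0 < d v.
  by case: posnP; [left | right].
  by rewrite /= d0 ?ltnn /= !muln0 ?muln1 h0 subr0 mul0r invr0 mulr0.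
rewrite /= muln_gt0 h0 d0 !muln1; split => //.
by rewrite natrM; field; rewrite !pnatr_eq0 -!lt0n h0 d0.
Qed.

Definition sum_below_rat n (F : nat -> rat) : rat := (\sum_(i < n) F i)%R.

(** The product [D] of all denominators is a common denominator, and each division of [D] by one of
    them is exact. *)
Lemma rat_recursive_sum k (F : nat -> seq nat -> rat) b :
  recursive k b -> rat_recursive k.+1 (fun w => F (head 0 w) (behead w)) ->
  rat_recursive k (fun v => sum_below_rat (b v) (fun i => F i v)).
Proof.
move=> rb [f [g [h [rf rg rh E]]]].
have cons_ext (f' : seq nat -> nat) : recursive k.+1 f' ->
    recursive k.+1 (fun w => f' (head 0 w :: behead w)).
  by move=> rf'; apply: recursive_ext rf' _ => -[|].
pose D v := prod_below (b v) (fun i => h (i :: v)).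
have rD : recursive k D.
  by apply: (recursive_prod (F := fun i v => h (i :: v))) => //; exact: cons_ext.
have rDh : recursive k.+1 (fun w => D (behead w) %/ h w).
  apply: recursive_div => //.
  case: rD => e De; exists (RComp e (map RProj (iota 1 k))) => v sv.
  have sb : size (behead v) = k by rewrite size_behead sv.
  apply: (receval_comp (w := behead v)); last exact: De.
    by rewrite size_map size_iota.
  move=> i; rewrite size_map size_iota => ik.
  by rewrite (nth_map 0) ?size_iota //= nth_iota // nth_behead.
exists (fun v => sum_below (b v) (fun i => f (i :: v) * (D v %/ h (i :: v)))).
exists (fun v => sum_below (b v) (fun i => g (i :: v) * (D v %/ h (i :: v)))).
exists D; split => //.
- apply: (recursive_sum (F := fun i v => f (i :: v) * (D v %/ h (i :: v)))) => //.
  exact: (cons_ext _ (recursive_mul rf rDh)).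
- apply: (recursive_sum (F := fun i v => g (i :: v) * (D v %/ h (i :: v)))) => //.
  exact: (cons_ext _ (recursive_mul rg rDh)).
move=> v sv; have E' i : 0 < h (i :: v) /\
    F i v = (((f (i :: v))%:R - (g (i :: v))%:R) / (h (i :: v))%:R)%R.
  by apply: (E (i :: v)); rewrite /= sv.
have D0 : 0 < D v by apply: prodn_gt0 => i; case: (E' i).
split=> //; rewrite /sum_below /sum_below_rat !natr_sum -sumrB mulr_suml.
apply: eq_bigr => i _; have [h0 ->] := E' i.
have /dvdnP[c Dc] : h (val i :: v) %| D v.
  by rewrite /D /prod_below (bigD1 i) //= dvdn_mulr.
move: D0; rewrite Dc mulnK // muln_gt0 => /andP[c0 _].
by rewrite !natrM; field; rewrite !pnatr_eq0 -!lt0n h0 c0.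
Qed.

Lemma decidable_rec_le_rat k p q : rat_recursive k p -> rat_recursive k q ->
  decidable_rec k (fun v => (p v <= q v)%R).
Proof.
move=> [f [g [h [rf rg rh E]]]] [f' [g' [h' [rf' rg' rh' E']]]].
apply: recursive_ext.
  exact: (decidable_rec_leq
    (recursive_add (recursive_mul rf rh') (recursive_mul rg' rh))
    (recursive_add (recursive_mul rf' rh) (recursive_mul rg rh'))).
move=> v sv /=; have [h0 ->] := E v sv; have [h0' ->] := E' v sv; congr nat_of_bool.
rewrite ler_pdivrMr ?ltr0n // mulrAC ler_pdivlMr ?ltr0n // !mulrBl.
rewrite lerBlDr addrAC lerBrDr -!natrM -!natrD ler_nat.
by congr (_ <= _); lia.
Qed.

Lemma decidable_rec_eq_rat k p q : rat_recursive k p -> rat_recursive k q ->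
  decidable_rec k (fun v => p v == q v).
Proof.
move=> rp rq; apply: recursive_ext.
  exact: decidable_rec_and (decidable_rec_le_rat rp rq) (decidable_rec_le_rat rq rp).
by move=> v _ /=; rewrite -eq_le.
Qed.

(* Head, tail, ... of the sequence coded by a number under [CodeSeq.code]. *)
Definition hdc x := sum_below x (fun i => x %% 2 ^ i.+1 == 0).
Definition tlc x := x %/ 2 ^ hdc x %/ 2.
Definition dropc x i := iteri i (fun _ z => tlc z) x.
Definition nthc x i := hdc (dropc x i).
Definition sizec x := sum_below x (fun i => 0 < dropc x i).

Lemma code_gt0 s : (0 < CodeSeq.code s) = (s != [::]).
Proof. by case: s => //= a s; rewrite muln_gt0 expn_gt0. Qed.

(** The code of [a :: s] is 2 ^ a times an odd number, so the head is the 2-adic valuation, which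
    [hdc] counts; the empty sequence has code 0. *)
Lemma hdc_code s : hdc (CodeSeq.code s) = head 0 s.
Proof.
case: s => [|a s] /=; first by rewrite /hdc /sum_below big_ord0.
set x := 2 ^ a * _; have x0 : 0 < x by rewrite muln_gt0 expn_gt0.
have lx : logn 2 x = a.
  rewrite lognM ?expn_gt0 // pfactorK // lognE /= dvdn2 /= odd_double /=.
  by rewrite addn0.
rewrite /hdc /sum_below (eq_bigr (fun i : 'I_x => nat_of_bool (i < a))).
  rewrite -/(sum_below x (fun i => i < a)) sum_belowE; apply/minn_idPr.
  by apply: ltnW; rewrite -lx ltn_logl.
by move=> i _; rewrite -[_ == 0]/(_ %| _) pfactor_dvdn // lx.
Qed.

Lemma tlc_code s : tlc (CodeSeq.code s) = CodeSeq.code (behead s).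
Proof.
rewrite /tlc hdc_code; case: s => [|a s] //=.
by rewrite mulKn ?expn_gt0 // divn2 /= uphalf_double.
Qed.

Lemma dropc_code s i : dropc (CodeSeq.code s) i = CodeSeq.code (drop i s).
Proof.
rewrite /dropc; elim: i => [|i /= ->]; first by rewrite drop0.
by rewrite tlc_code -drop1 drop_drop add1n.
Qed.

Lemma nthc_code s i : nthc (CodeSeq.code s) i = nth 0 s i.
Proof. by rewrite /nthc dropc_code hdc_code -nth0 nth_drop addn0. Qed.

Lemma size_leq_code s : size s <= CodeSeq.code s.
Proof.
elim: s => //= a s IH; apply: (@leq_trans (CodeSeq.code s).*2.+1); first by lia.
by rewrite leq_pmull // expn_gt0.
Qed.

Lemma sizec_code s : sizec (CodeSeq.code s) = size s.
Proof.
rewrite /sizec /sum_below.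
rewrite (eq_bigr (fun i : 'I_(CodeSeq.code s) => nat_of_bool (i < size s))).
  rewrite -/(sum_below _ (fun i => i < size s)) sum_belowE; apply/minn_idPr.
  exact: size_leq_code.
by move=> i _; rewrite dropc_code code_gt0 -size_eq0 size_drop subn_eq0 -ltnNge.
Qed.

Lemma recursive_hdc k f : recursive k f -> recursive k (fun v => hdc (f v)).
Proof.
apply: recursive_comp1.
apply: (recursive_sum (F := fun i v => nth 0 v 0 %% 2 ^ i.+1 == 0)); first by rec_var.
apply: decidable_rec_eq; last exact: recursive_const.
apply: recursive_mod; first by rec_var.
apply: recursive_exp; first exact: recursive_const.
by apply: recursive_succ; rec_var.
Qed.

Lemma recursive_tlc k f : recursive k f -> recursive k (fun v => tlc (f v)).
Proof.
move=> rf; apply: recursive_div; last exact: recursive_const.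
apply: recursive_div => //; apply: recursive_exp; first exact: recursive_const.
exact: recursive_hdc.
Qed.

Lemma recursive_dropc k f g : recursive k f -> recursive k g ->
  recursive k (fun v => dropc (f v) (g v)).
Proof.
move=> rf rg; apply: (recursive_iteri (g := fun _ z _ => tlc z)) => //.
by apply: recursive_tlc; rec_var.
Qed.

Lemma recursive_nthc k f g : recursive k f -> recursive k g ->
  recursive k (fun v => nthc (f v) (g v)).
Proof. by move=> rf rg; apply: recursive_hdc; apply: recursive_dropc. Qed.

Lemma recursive_sizec k f : recursive k f -> recursive k (fun v => sizec (f v)).
Proof.
apply: recursive_comp1.
apply: (recursive_sum (F := fun i v => 0 < dropc (nth 0 v 0) i)); first by rec_var.
apply: decidable_rec_leq; first exact: recursive_const.
by apply: recursive_dropc; rec_var.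
Qed.

Lemma recursive_code k f (s : seq nat -> seq nat) :
  recursive k f -> recursive k (fun v => CodeSeq.code (s v)) ->
  recursive k (fun v => CodeSeq.code (f v :: s v)).
Proof.
move=> rf rs; apply: recursive_mul.
  by apply: recursive_exp => //; exact: recursive_const.
apply: recursive_succ; apply: recursive_ext (recursive_add rs rs) _ => v _.
by rewrite addnn.
Qed.

Definition codef n (F : nat -> nat) := CodeSeq.code [seq F i | i <- iota 0 n].

(** The iteration adds entries in front, so step [i] must supply the entry of index [b v - i.+1]. *)
Lemma recursive_codef k (F : nat -> seq nat -> nat) b :
  recursive k b -> recursive k.+1 (fun w => F (head 0 w) (behead w)) ->
  recursive k (fun v => codef (b v) (fun i => F i v)).
Proof.
move=> rb rF.
have /= H := recursive_iteri
  (g := fun i z v => CodeSeq.code (F (b v - i.+1) v :: CodeSeq.decode z))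
  _ (recursive_const k 0) rb.
apply: recursive_ext; first apply: H.
  apply: recursive_mul; last first.
    apply: recursive_succ; apply: recursive_ext.
      by apply: (@recursive_add _ (fun w => head 0 (behead w))
        (fun w => head 0 (behead w))); rec_var.
    by move=> v _; rewrite CodeSeq.decodeK addnn.
  apply: recursive_exp; first exact: recursive_const.
  apply: (recursive_weaken2 (F := fun i v => F (b v - i.+1) v)).
  have rb' : recursive k.+1 (fun w => b (behead w) - (head 0 w).+1).
    apply: recursive_sub; last by apply: recursive_succ; rec_var.
    case: rb => e De; exists (RComp e (map RProj (iota 1 k))) => v sv.
    have sb : size (behead v) = k by rewrite size_behead sv.
    apply: (receval_comp (w := behead v)); last exact: De.
      by rewrite size_map size_iota.
    move=> i; rewrite size_map size_iota => ik.
    by rewrite (nth_map 0) ?size_iota //= nth_iota // nth_behead.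
  apply: recursive_ext.
    apply: (recursive_let (F := fun z w => F z (behead w))) rb'.
    exact: recursive_weaken2.
  by [].
move=> v _ /=; rewrite /codef.
suff Hi i : i <= b v -> iteri i (fun i z => 2 ^ F (b v - i.+1) v *
    (CodeSeq.code (CodeSeq.decode z)).*2.+1) 0 =
  CodeSeq.code [seq F i v | i <- iota (b v - i) i].
  by rewrite Hi // subnn.
elim: i => [|i IH] //= ib; rewrite IH ?(ltnW ib) // CodeSeq.decodeK.
by rewrite -[X in iota X i]subSS subSn.
Qed.

(** The order of the listed items is immaterial; [rev] matches an iteration that adds entries in
    front. *)
Definition codef_filter n (P : pred nat) (F : nat -> nat) :=
  CodeSeq.code [seq F i | i <- rev (iota 0 n) & P i].

Lemma recursive_codef_filter k (P : nat -> seq nat -> bool) (F : nat -> seq nat -> nat) b :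
  recursive k b -> decidable_rec k.+1 (fun w => P (head 0 w) (behead w)) ->
  recursive k.+1 (fun w => F (head 0 w) (behead w)) ->
  recursive k (fun v => codef_filter (b v) (fun i => P i v) (fun i => F i v)).
Proof.
move=> rb rP rF.
have /= H := recursive_iteri
  (g := fun i z v => if P i v then 2 ^ F i v * (z + z).+1 else z)
  _ (recursive_const k 0) rb.
apply: recursive_ext; first apply: H.
  apply: recursive_if; [exact: (recursive_weaken2 (F := fun i v => P i v : nat))| |by rec_var].
  apply: recursive_mul; last by apply: recursive_succ; apply: recursive_add; rec_var.
  apply: recursive_exp; first exact: recursive_const.
  exact: recursive_weaken2.
move=> v _ /=; rewrite /codef_filter; elim: (b v) => [|n IH]; first by [].
rewrite [LHS]/= IH.
have -> : iota 0 n.+1 = rcons (iota 0 n) n by rewrite -addn1 iotaD cats1.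
by rewrite rev_rcons /=; case: (P n v) => //=; rewrite addnn.
Qed.

(* A number [w] codes the finite function [digit b w]. *)
Definition digit b w i := (w %/ b ^ i) %% b.

Lemma recursive_digit k f g h : recursive k f -> recursive k g -> recursive k h ->
  recursive k (fun v => digit (f v) (g v) (h v)).
Proof.
move=> rf rg rh; apply: recursive_mod => //; apply: recursive_div => //.
exact: recursive_exp.
Qed.

Lemma digit_lt b w i : 0 < b -> digit b w i < b.
Proof. exact: ltn_pmod. Qed.

Lemma digit_exists b n (f : nat -> nat) : (forall i, i < n -> f i < b) ->
  exists2 w, w < b ^ n & forall i, i < n -> digit b w i = f i.
Proof.
elim: n => [|n IH] fb; first by exists 0.
have [i lin|w wb wf] := IH; first by apply: fb; exact: ltnW.
have b0 : 0 < b by exact: leq_ltn_trans (fb n (ltnSn n)).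
have bn0 : 0 < b ^ n by rewrite expn_gt0 b0.
exists (f n * b ^ n + w).
  rewrite expnS; apply: (@leq_trans ((f n).+1 * b ^ n)).
    by rewrite mulSn addnC ltn_add2r.
  by rewrite leq_mul2r fb ?orbT.
move=> i; rewrite ltnS leq_eqVlt => /orP[/eqP ->|lin].
  by rewrite /digit divnMDl // divn_small // addn0 modn_small // fb.
have bn : b ^ n = b ^ (n - i) * b ^ i by rewrite -expnD subnK // ltnW.
rewrite -(wf i) // /digit bn mulnA divnMDl ?expn_gt0 ?b0 //.
by rewrite -(subnSK lin) expnS mulnCA -modnDml modnMr add0n.
Qed.

Lemma digit_inj b n w w' : w < b ^ n -> w' < b ^ n ->
  (forall i, i < n -> digit b w i = digit b w' i) -> w = w'.
Proof.
elim: n w w' => [|n IH] w w'; first by rewrite expn0 !ltnS !leqn0 => /eqP-> /eqP->.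
case: (posnP b) => [->|b0]; first by rewrite exp0n.
rewrite expnS => wb wb' H.
rewrite (divn_eq w b) (divn_eq w' b); congr (_ * _ + _); last first.
  by have := H 0 isT; rewrite /digit expn0 !divn1.
apply: IH; rewrite ?ltn_divLR 1?[_ ^ _ * _]mulnC // => i lin.
by have := H i.+1 lin; rewrite /digit expnS !divnMA.
Qed.

Definition entry b w w' D i : rat :=
  (((digit b w i)%:R - (digit b w' i)%:R) / D%:R)%R.

Lemma rat_recursive_entry k b w w' D i :
  recursive k b -> recursive k w -> recursive k w' -> recursive k D ->
  recursive k i ->
  rat_recursive k (fun v => entry (b v) (w v) (w' v) (D v) (i v)).
Proof.
move=> rb rw rw' rD ri; apply: rat_recursive_divn => //.
by apply: rat_recursive_sub; apply: rat_recursive_nat; apply: recursive_digit.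
Qed.

(** * Bounded search over finite tables *)

Definition has_digits c (Phi : (nat -> nat) -> bool) :=
  has_below c (fun b => has_below c (fun w => Phi (digit b w))).

(** The bound [c0] is chosen before [Phi], because in nested searches [Phi] depends on [c] and on
    the other tables. A code controls the first [n] values only, hence the form of the assumption on
    [Phi]. *)
Lemma has_digits_eventually n (f : nat -> nat) : exists c0, forall c (Phi : _ -> bool),
  c0 <= c -> (forall g, (forall i, i < n -> g i = f i) -> Phi g) -> has_digits c Phi.
Proof.
pose b := (\max_(i < n) f i).+1.
have fb i : i < n -> f i < b.
  by move=> lin; rewrite ltnS (leq_bigmax (Ordinal lin)).
have [w wb wf] := digit_exists fb; exists (b + w).+1 => c Phi c0 H.
apply/has_belowP; exists b; first by lia.
apply/has_belowP; exists w; first by lia.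
exact: H.
Qed.

Definition has_table c (Phi : (nat -> rat) -> bool) :=
  has_below c (fun b => has_below c (fun w => has_below c (fun w' =>
    has_below c (fun D => Phi (entry b w w' D))))).

Lemma common_denominator n (f : nat -> rat) : exists D, 0 < D /\ exists p q : nat -> nat,
  forall i, i < n -> f i = (((p i)%:R - (q i)%:R) / D%:R)%R.
Proof.
pose d i := `|denq (f i)|%N; have d0 i : 0 < d i by rewrite absz_gt0.
pose D := \prod_(i < n) d i; have D0 : 0 < D by apply: prodn_gt0.
exists D; split=> //.
pose z i := (numq (f i) * Posz (D %/ d i))%R.
exists (fun i => if (0 <= z i)%R then `|z i|%N else 0).
exists (fun i => if (0 <= z i)%R then 0 else `|z i|%N) => i lin.
have -> : ((if (0 <= z i)%R then `|z i|%N else 0)%:R -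
    (if (0 <= z i)%R then 0 else `|z i|%N)%:R = (z i)%:~R :> rat)%R.
  by case: ltrP => z0; rewrite ?subr0 ?sub0r natr_absz -?rmorphN; congr (_%:~R)%R; lia.
have /dvdnP[c Dc] : d i %| D by rewrite /D (bigD1 (Ordinal lin)) //= dvdn_mulr.
rewrite /z Dc mulnK // -{1}[f i]divq_num_den rmorphM natrM /=.
move: D0; rewrite Dc muln_gt0 => /andP[c0 _].
have -> : denq (f i) = Posz (d i) by rewrite /d; have := denq_gt0 (f i); lia.
by rewrite -!pmulrn; field; rewrite ?intr_eq0 !pnatr_eq0 -!lt0n c0 d0.
Qed.

Lemma has_table_eventually n (f : nat -> rat) : exists c0, forall c (Phi : _ -> bool),
  c0 <= c -> (forall g, (forall i, i < n -> g i = f i) -> Phi g) -> has_table c Phi.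
Proof.
have [D [D0 [p [q fE]]]] := common_denominator n f.
pose b := (\max_(i < n) (p i + q i)).+1.
have pqb i : i < n -> p i + q i < b.
  by move=> lin; rewrite ltnS (leq_bigmax (F := fun i : 'I_n => p i + q i) (Ordinal lin)).
have [|w _ wE] := @digit_exists b n p; first by move=> i /pqb; lia.
have [|w' _ wE'] := @digit_exists b n q; first by move=> i /pqb; lia.
exists (b + w + w' + D).+1 => c Phi c0 H.
apply/has_belowP; exists b; first by lia.
apply/has_belowP; exists w; first by lia.
apply/has_belowP; exists w'; first by lia.
apply/has_belowP; exists D; first by lia.
by apply: H => i lin; rewrite /entry wE // wE' // fE.
Qed.

Lemma has_digitsP c (Phi : (nat -> nat) -> bool) : has_digits c Phi -> exists g, Phi g.
Proof. by case/has_belowP=> b _ /has_belowP[w _ H]; exists (digit b w). Qed.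

Lemma has_tableP c (Phi : (nat -> rat) -> bool) : has_table c Phi -> exists g, Phi g.
Proof.
case/has_belowP=> b _ /has_belowP[w _ /has_belowP[w' _ /has_belowP[D _ H]]].
by exists (entry b w w' D).
Qed.

(** * Codes of integers and rationals *)

(** An integer is coded as an element of a sum type: two components, one a singleton and the other
    empty, with code 0. As [Negz k] stands for - (k + 1), the negative case stores [q - p.+1]. *)
Definition diff_code p q :=
  if q <= p then CodeSeq.code [:: CodeSeq.code [:: p - q]; 0]
  else CodeSeq.code [:: 0; CodeSeq.code [:: q - p.+1]].

Lemma pickle_diff p q : pickle (Posz p - Posz q)%R = diff_code p q.
Proof.
rewrite /diff_code; case: leqP => pq.
  by have -> : (Posz p - Posz q = Posz (p - q))%R by lia.
by have -> : (Posz p - Posz q = Negz (q - p.+1))%R by lia.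
Qed.

(** This counts the [i] below some common divisor [e.+1], that is, the [i] below the greatest
    one. *)
Definition gcdc a N := sum_below N (fun i => has_below N (fun e =>
  (i <= e) && (a %% e.+1 == 0) && (N %% e.+1 == 0))).

Lemma gcdcE a N : 0 < N -> gcdc a N = gcdn a N.
Proof.
move=> N0; have gN : gcdn a N <= N by rewrite dvdn_leq ?dvdn_gcdr.
have g0 : 0 < gcdn a N by rewrite gcdn_gt0 N0 orbT.
rewrite /gcdc /sum_below (eq_bigr (fun i : 'I_N => nat_of_bool (i < gcdn a N))).
  by rewrite -/(sum_below N (fun i => i < gcdn a N)) sum_belowE; apply/minn_idPr.
move=> i _; congr nat_of_bool; apply/has_belowP/idP.
  case=> e _ /andP[/andP[ie ea] eN]; apply: (leq_ltn_trans ie).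
  by apply: dvdn_leq => //; rewrite dvdn_gcd /dvdn ea eN.
move=> ig; exists (gcdn a N).-1; rewrite prednK //.
by rewrite -ltnS prednK // ig -/(_ %| a) -/(_ %| N) dvdn_gcdl dvdn_gcdr.
Qed.

Definition frac_code a N := CodeSeq.code
  [:: diff_code (a %/ gcdc a N) 0; diff_code (N %/ gcdc a N) 0].

Lemma pickle_frac a N : 0 < N -> pickle (a%:R / N%:R : rat)%R = frac_code a N.
Proof.
move=> N0; rewrite /frac_code gcdcE // -!pickle_diff !subr0.
have g0 : 0 < gcdn a N by rewrite gcdn_gt0 N0 orbT.
set g := gcdn a N in g0 *.
have d0 : 0 < N %/ g by rewrite divn_gt0 // dvdn_leq ?dvdn_gcdr.
have cop : coprime (a %/ g) (N %/ g).
  rewrite /coprime -(eqn_pmul2r g0) mul1n muln_gcdl !divnK ?dvdn_gcdl ?dvdn_gcdr //.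
have -> : (a%:R / N%:R : rat)%R = ((Posz (a %/ g))%:~R / (Posz (N %/ g))%:~R)%R.
  have -> : (a%:R = (a %/ g)%:R * g%:R :> rat)%R by rewrite -natrM divnK ?dvdn_gcdl.
  have -> : (N%:R = (N %/ g)%:R * g%:R :> rat)%R by rewrite -natrM divnK ?dvdn_gcdr.
  rewrite -!pmulrn.
  by field; rewrite !pnatr_eq0 -!lt0n g0 d0.
set q := (_ / _)%R.
have -> : pickle q = CodeSeq.code [:: pickle (numq q); pickle (denq q)] by [].
rewrite coprimeq_num // coprimeq_den //.
by rewrite eqz_nat gtn_eqF // gtr0_sg // mul1r ger0_norm.
Qed.

(* These decode the [pickle] codes of integers and rationals. *)
Definition intc z : rat :=
  ((nthc (nthc z 0) 0)%:R - ((nthc (nthc z 1) 0).+1 * (nthc z 0 == 0))%:R)%R.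
Definition ratc r : rat := (intc (nthc r 0) / (nthc (nthc (nthc r 1) 0) 0)%:R)%R.

(** Codes of nonempty sequences are positive, so a first component 0 singles out the negative
    integers. *)
Lemma intc_pickle z : intc (pickle z) = (z%:~R)%R.
Proof.
rewrite /intc; case: z => p.
  rewrite -[pickle (Posz p)]/(CodeSeq.code [:: CodeSeq.code [:: p]; 0]) !nthc_code.
  rewrite -[nth 0 [:: CodeSeq.code _; 0] 0]/(CodeSeq.code [:: p]) ?nthc_code.
  by rewrite eqn0Ngt code_gt0 muln0 subr0.
rewrite -[pickle (Negz p)]/(CodeSeq.code [:: 0; CodeSeq.code [:: p]]) !nthc_code.
rewrite -[nth 0 [:: 0; _] 0]/(CodeSeq.code [::]) nthc_code.
by rewrite /= muln1 sub0r NegzE rmorphN.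
Qed.

Lemma ratc_pickle q : ratc (pickle q) = q.
Proof.
have E a b : ratc (CodeSeq.code [:: a; b]) = (intc a / (nthc (nthc b 0) 0)%:R)%R.
  by rewrite /ratc !nthc_code.
have -> : pickle q = CodeSeq.code [:: pickle (numq q); pickle (denq q)].
  by case: q => -[].
rewrite E intc_pickle -[RHS]divq_num_den.
have [d -> d0] : exists2 d, denq q = Posz d & 0 < d.
  by exists `|denq q|%N; have := denq_gt0 q; lia.
rewrite -[pickle (Posz d)]/(CodeSeq.code [:: CodeSeq.code [:: d]; 0]) nthc_code.
by rewrite nthc_code.
Qed.

Lemma recursive_diff_code k f g : recursive k f -> recursive k g ->
  recursive k (fun v => diff_code (f v) (g v)).
Proof.
move=> rf rg; apply: recursive_if; first exact: decidable_rec_leq.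
  apply: recursive_code; last exact: recursive_const.
  by apply: recursive_code; [exact: recursive_sub | exact: recursive_const].
apply: recursive_code; first exact: recursive_const.
apply: (recursive_code (s := fun=> [::])); last exact: recursive_const.
apply: (recursive_code (s := fun=> [::])); last exact: recursive_const.
by apply: recursive_sub => //; exact: recursive_succ.
Qed.

Lemma recursive_gcdc k f g : recursive k f -> recursive k g ->
  recursive k (fun v => gcdc (f v) (g v)).
Proof.
apply: recursive_comp2.
pose F e i v := (i <= e) && (nth 0 v 0 %% e.+1 == 0) && (nth 0 v 1 %% e.+1 == 0).
apply: (recursive_sum (F := fun i v => has_below (nth 0 v 1) (fun e => F e i v))).
  by rec_var.
apply: (decidable_rec_has (P := fun e v => F e (head 0 v) (behead v))); first by rec_var.
have rm i j : recursive 4 (fun w => nth 0 (behead (behead w)) i %% (nth 0 w j).+1).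
  by apply: recursive_mod; [|apply: recursive_succ]; rec_var.
apply: decidable_rec_and; first apply: decidable_rec_and.
- by apply: decidable_rec_leq; rec_var.
- apply: decidable_rec_eq; last exact: recursive_const.
  by apply: recursive_mod; [|apply: recursive_succ]; rec_var.
- apply: decidable_rec_eq; last exact: recursive_const.
  by apply: recursive_mod; [|apply: recursive_succ]; rec_var.
Qed.

Lemma recursive_frac_code k f g : recursive k f -> recursive k g ->
  recursive k (fun v => frac_code (f v) (g v)).
Proof.
move=> rf rg; have rG := recursive_gcdc rf rg; have r0 := recursive_const k 0.
by do 2![apply: recursive_code; first
  by apply: recursive_diff_code => //; exact: recursive_div].
Qed.

Lemma rat_recursive_ratc k f : recursive k f -> rat_recursive k (fun v => ratc (f v)).
Proof.
move=> rf; have rc := @recursive_const k.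
apply: rat_recursive_divn; last by do 3!apply: recursive_nthc => //.
apply: rat_recursive_sub; apply: rat_recursive_nat; first by do 3!apply: recursive_nthc => //.
apply: recursive_mul; first by apply: recursive_succ; do 3!apply: recursive_nthc => //.
by apply: decidable_rec_eq => //; do 2!apply: recursive_nthc => //.
Qed.

(** * The algorithm *)

Section Program.
Variables (n m : nat) (d : nat -> nat) (phi : nat -> nat -> nat -> rat).

(** Bounds the coefficients and right-hand sides of all defining inequalities: differences of ranks
    are at most [n], and the box constraints have coefficients 1 and -1 even if [n] is 0. *)
Definition coef_bound := n.+1.
(* By Cramer's rule and the Leibniz formula, the common denominator of the
   coordinates of a vertex is at most [m! (n + 1)^m]; so it divides the
   following number. *)
Definition grid_den := (m`! * coef_bound ^ m)`!.
(** A grid point is a number with [m] digits, the numerators of its coordinates; these run from 0 to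
    [grid_den] inclusive, hence the base. *)
Definition grid_size := grid_den.+1 ^ m.
Definition grid_num xi j := digit grid_den.+1 xi j.

(** [A] tabulates the matrices of the certificate and [B] a left inverse of the map X |-> (A_j X
    phi_j)_j; the inverse turns injectivity into finitely many equations. The scaling factor of the
    certificate is [k.+1], hence positive. *)
Definition member_cert xi c :=
  has_below c (fun k => has_table c (fun A => has_table c (fun B =>
    all_below n (fun i => all_below (k.+1 * grid_den) (fun a =>
    all_below n (fun i' => all_below (k.+1 * grid_den) (fun a' =>
      sum_below_rat m (fun j =>
      sum_below_rat (k.+1 * grid_num xi j) (fun r =>
      sum_below_rat (d j) (fun l =>
        (phi j i l * A (CodeSeq.code [:: j; r; a])
          * B (CodeSeq.code [:: j; r; l; i'; a']))%R)))
      == ((i == i') && (a == a'))%:R%R))))))).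

(** The rows of [U] span a violating subspace. A right inverse [U'] shows that its dimension is [r],
    and a factorization of [U phi_j] as [C_j G_j] through dimension [rho j] bounds the dimension of
    its image. *)
Definition nonmember_cert xi c :=
  has_below c (fun r => has_digits c (fun rho =>
  has_table c (fun U => has_table c (fun U' =>
  has_table c (fun C => has_table c (fun G =>
    [&& all_below r (fun a => all_below r (fun a' =>
          sum_below_rat n (fun i =>
            (U (CodeSeq.code [:: a; i]) * U' (CodeSeq.code [:: i; a']))%R)
          == (a == a')%:R%R)),
        all_below m (fun j => all_below r (fun a => all_below (d j) (fun l =>
          sum_below_rat n (fun i => (U (CodeSeq.code [:: a; i]) * phi j i l)%R)
          == sum_below_rat (rho j) (fun t =>
            (C (CodeSeq.code [:: j; a; t]) * G (CodeSeq.code [:: j; t; l]))%R))))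
      & sum_below m (fun j => grid_num xi j * rho j) < grid_den * r])))))).

Definition search_check c :=
  all_below grid_size (fun xi => member_cert xi c || nonmember_cert xi c).

(** Digits shifted by [coef_bound] represent the integers from [- coef_bound] to [coef_bound]. An
    inequality has [m.+1] digits, the last one for the right-hand side. *)
Definition ineq_base := (coef_bound + coef_bound).+1.
Definition ineq_count := ineq_base ^ m.+1.
Definition ineq_lhs la j : rat := ((digit ineq_base la j)%:R - coef_bound%:R)%R.

(* [N (b - a_1 s_1 - ... - a_m s_m)], for the inequality with index [la] at the
   grid point [s] with index [xi]. *)
Definition slack la xi : rat :=
  (ineq_lhs la m * grid_den%:R
   - sum_below_rat m (fun j => (ineq_lhs la j * (grid_num xi j)%:R)%R))%R.

Definition valid_ineq c la :=
  all_below grid_size (fun xi => member_cert xi c ==> (0 <= slack la xi)%R).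

Definition extreme_grid c xi := member_cert xi c &&
  all_below grid_size (fun up => member_cert up c && (up != xi) ==>
    has_below ineq_count (fun la =>
      [&& valid_ineq c la, slack la xi == 0%R & slack la up != 0%R])).

Definition output_code c := CodeSeq.code
  [:: codef_filter ineq_count (valid_ineq c) (fun la => CodeSeq.code
        [:: codef m (fun j => diff_code (digit ineq_base la j) coef_bound);
            diff_code (digit ineq_base la m) coef_bound]);
      codef_filter grid_size (extreme_grid c) (fun xi =>
        codef m (fun j => frac_code (grid_num xi j) grid_den))].
End Program.

(** * Recursiveness in the coded datum *)

Definition in_dim x := nthc x 0.
Definition in_m x := sizec (nthc x 1).
Definition in_dimj x j := nthc (nthc (nthc x 1) j) 0.
Definition in_phi x j i l := ratc (nthc (nthc (nthc (nthc (nthc x 1) j) 1) i) l).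

(* The order matters: [apply] unfolds definitions, so the lemmas for defined
   operators come before those for the arithmetic operations they unfold to. *)
Ltac recur := repeat first
  [ assumption
  | eapply recursive_varE; intro; rewrite -?nth0 ?nth_behead; reflexivity
  | apply: recursive_const
  | apply: recursive_frac_code
  | apply: recursive_diff_code
  | apply: recursive_codef_filter
  | apply: recursive_codef
  | apply: recursive_code
  | apply: recursive_nthc
  | apply: recursive_sizec
  | apply: recursive_digit
  | apply: recursive_sum
  | apply: recursive_succ
  | apply: recursive_add
  | apply: recursive_mul
  | apply: recursive_exp
  | apply: recursive_fact
  | apply: decidable_rec_all
  | apply: decidable_rec_has
  | apply: decidable_rec_leq
  | apply: decidable_rec_eq_rat
  | apply: decidable_rec_eq
  | apply: decidable_rec_and
  | apply: decidable_rec_or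
  | apply: decidable_rec_imply
  | apply: decidable_rec_neg
  | apply: decidable_rec_le_rat
  | apply: rat_recursive_const0
  | apply: rat_recursive_entry
  | apply: rat_recursive_ratc
  | apply: rat_recursive_sum
  | apply: rat_recursive_sub
  | apply: rat_recursive_mul
  | apply: rat_recursive_nat ].

Lemma recursive_comp3 k F f g h :
  recursive 3 (fun w => F (nth 0 w 0) (nth 0 w 1) (nth 0 w 2)) ->
  recursive k f -> recursive k g -> recursive k h ->
  recursive k (fun v => F (f v) (g v) (h v)).
Proof.
case=> e Fe [ef fe] [eg ge] [eh he]; exists (RComp e [:: ef; eg; eh]) => v sv.
apply: (receval_comp (w := [:: f v; g v; h v])) => //; last exact: Fe.
by case=> [|[|[]]] //= _; [exact: fe | exact: ge | exact: he].
Qed.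

(** As named functions of the coded input, the formulas can be treated as atoms once they are known
    to be decidable. *)
Definition member_code x := member_cert (in_dim x) (in_m x) (in_dimj x) (in_phi x).
Definition nonmember_code x :=
  nonmember_cert (in_dim x) (in_m x) (in_dimj x) (in_phi x).
Definition search_code x := search_check (in_dim x) (in_m x) (in_dimj x) (in_phi x).
Definition valid_code x := valid_ineq (in_dim x) (in_m x) (in_dimj x) (in_phi x).
Definition extreme_code x := extreme_grid (in_dim x) (in_m x) (in_dimj x) (in_phi x).

Lemma recursive_grid_den k f g : recursive k f -> recursive k g ->
  recursive k (fun v => grid_den (f v) (g v)).
Proof. by rewrite /grid_den /coef_bound => *; recur. Qed.

Lemma decidable_rec_member k x xi c :
  recursive k x -> recursive k xi -> recursive k c ->
  decidable_rec k (fun v => member_code (x v) (xi v) (c v)).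
Proof.
apply: (recursive_comp3 (F := fun x xi c => member_code x xi c : nat)).
have D k' f g := @recursive_grid_den k' f g.
rewrite /member_code /member_cert /grid_num /has_table /in_dim /in_m /in_dimj /in_phi.
by repeat first [progress recur | apply: D].
Qed.

Lemma decidable_rec_nonmember k x xi c :
  recursive k x -> recursive k xi -> recursive k c ->
  decidable_rec k (fun v => nonmember_code (x v) (xi v) (c v)).
Proof.
apply: (recursive_comp3 (F := fun x xi c => nonmember_code x xi c : nat)).
have D k' f g := @recursive_grid_den k' f g.
rewrite /nonmember_code /nonmember_cert /grid_num /has_table /has_digits
  /in_dim /in_m /in_dimj /in_phi.
by repeat first [progress recur | apply: D].
Qed.

Lemma decidable_rec_search k x c : recursive k x -> recursive k c ->
  decidable_rec k (fun v => search_code (x v) (c v)).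
Proof.
apply: (recursive_comp2 (f := fun x c => search_code x c : nat)).
have D k' f g := @recursive_grid_den k' f g.
have M k' f g h := @decidable_rec_member k' f g h.
have M' k' f g h := @decidable_rec_nonmember k' f g h.
rewrite /search_code /search_check -/(member_code _) -/(nonmember_code _) /grid_size
  /in_dim /in_m.
repeat first [apply: M | apply: M' | apply: D | progress recur].
Qed.

Lemma decidable_rec_valid k x c la :
  recursive k x -> recursive k c -> recursive k la ->
  decidable_rec k (fun v => valid_code (x v) (c v) (la v)).
Proof.
apply: (recursive_comp3 (F := fun x xi c => valid_code x xi c : nat)).
have D k' f g := @recursive_grid_den k' f g.
have M k' f g h := @decidable_rec_member k' f g h.
rewrite /valid_code /valid_ineq -/(member_code _) /grid_size /slack /ineq_lhs
   /ineq_base /grid_num /coef_bound /in_dim /in_m.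
repeat first [apply: M | apply: D | progress recur].
Qed.

Lemma decidable_rec_extreme k x c xi :
  recursive k x -> recursive k c -> recursive k xi ->
  decidable_rec k (fun v => extreme_code (x v) (c v) (xi v)).
Proof.
apply: (recursive_comp3 (F := fun x xi c => extreme_code x xi c : nat)).
have D k' f g := @recursive_grid_den k' f g.
have M k' f g h := @decidable_rec_member k' f g h.
have V k' f g h := @decidable_rec_valid k' f g h.
rewrite /extreme_code /extreme_grid -/(member_code _) -/(valid_code _) /grid_size
  /ineq_count /slack /ineq_lhs /ineq_base /grid_num /coef_bound /in_dim /in_m.
repeat first [apply: M | apply: V | apply: D | progress recur].
Qed.

Lemma recursive_output k x c : recursive k x -> recursive k c ->
  recursive k (fun v => output_code (in_dim (x v)) (in_m (x v)) (in_dimj (x v))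
                          (in_phi (x v)) (c v)).
Proof.
apply: (recursive_comp2 (f := fun x c =>
  output_code (in_dim x) (in_m x) (in_dimj x) (in_phi x) c)).
have D k' f g := @recursive_grid_den k' f g.
have V k' f g h := @decidable_rec_valid k' f g h.
have E k' f g h := @decidable_rec_extreme k' f g h.
rewrite /output_code -/(valid_code _) -/(extreme_code _) /grid_size
  /ineq_count /ineq_base /grid_num /coef_bound /in_dim /in_m.
repeat first [apply: E | apply: V | apply: D | progress recur].
Qed.

Lemma recursive_search : exists alg, forall x c,
  (search_code x c /\ forall c', c' < c -> ~~ search_code x c') ->
  receval alg [:: x] (output_code (in_dim x) (in_m x) (in_dimj x) (in_phi x) c).
Proof.
(* Minimization looks for a zero, so it is applied to the negated check. *)
have [es esE] : decidable_rec 2 (fun v => ~~ search_code (nth 0 v 1) (nth 0 v 0)).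
  by apply: decidable_rec_neg; apply: decidable_rec_search; apply: recursive_var.
have [eo eoE] := recursive_output (recursive_var 2 0) (recursive_var 2 1).
exists (RComp eo [:: RProj 0; RMu es]) => x c [sc nsc].
apply: (receval_comp (w := [:: x; c])) => //; last exact: (eoE [:: x; c]).
case=> [|[]] //= _; split; first by have := esE [:: c; x] erefl; rewrite /= sc.
move=> c' /nsc H; exists 0; by have := esE [:: c'; x] erefl; rewrite /= H.
Qed.

Local Open Scope ring_scope.

(** * Polytopes *)

Definition dot (F : pzRingType) m (c : 'I_m -> F) (s : 'rV[F]_m) : F :=
  \sum_j c j * s 0 j.

Lemma dotD (F : pzRingType) m (c : 'I_m -> F) s t : dot c (s + t) = dot c s + dot c t.
Proof. by rewrite /dot -big_split; apply: eq_bigr => j _; rewrite mxE mulrDr. Qed.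

Lemma dotZ (F : comPzRingType) m (c : 'I_m -> F) k s : dot c (k *: s) = k * dot c s.
Proof. by rewrite /dot mulr_sumr; apply: eq_bigr => j _; rewrite mxE mulrCA. Qed.

Lemma dotN (F : pzRingType) m (c : 'I_m -> F) s : dot c (- s) = - dot c s.
Proof. by rewrite /dot -sumrN; apply: eq_bigr => j _; rewrite mxE mulrN. Qed.

Definition convex_pred (F : numDomainType) (E : lmodType F) (Q : E -> Prop) :=
  forall x y t, Q x -> Q y -> 0 < t < 1 -> Q (t *: x + (1 - t) *: y).

Section Polytope.
Variables (F : realFieldType) (m : nat) (I : finType).
Variables (a : I -> 'I_m -> F) (b : I -> F).

Definition sol (s : 'rV[F]_m) := forall i, dot (a i) s <= b i.
Definition tight (s : 'rV[F]_m) (i : I) := dot (a i) s == b i.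
(** Extremality in rank form: the tight constraints have full column rank. Cramer's rule applies
    directly to this form. *)
Definition vertex (s : 'rV[F]_m) :=
  forall v, (forall i, tight s i -> dot (a i) v = 0) -> v = 0.

Hypothesis bounded : forall v, v != 0 -> exists i, 0 < dot (a i) v.

(** Ratio test: move along [v] until the first constraint [i0] becomes tight. Constraints tight at
    [s] stay tight because they vanish on [v], and [i0] is a new one. *)
Lemma sol_exit s v : sol s -> v != 0 -> (forall i, tight s i -> dot (a i) v = 0) ->
  exists t, [/\ 0 < t, sol (s + t *: v) &
    (#|[pred i | ~~ tight (s + t *: v) i]| < #|[pred i | ~~ tight s i]|)%N].
Proof.
move=> ss v0 vt; have [i1 i1v] := bounded v0.
pose r i := (b i - dot (a i) s) / dot (a i) v.
case: (arg_minP (P := fun i => 0 < dot (a i) v) r i1v) => i0 i0v rmin.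
have nt0 : ~~ tight s i0.
  by apply: contraL i0v => /vt ->; rewrite ltxx.
have r0 : 0 < r i0.
  by rewrite divr_gt0 // subr_gt0 lt_neqAle ss andbT.
have tE i : dot (a i) (s + r i0 *: v) = dot (a i) s + r i0 * dot (a i) v.
  by rewrite dotD dotZ.
exists (r i0); split => //.
  move=> i; rewrite tE -lerBrDl; have [iv|iv] := ltrP 0 (dot (a i) v).
    by rewrite -ler_pdivlMr //; exact: rmin.
  apply: (@le_trans _ _ 0); first by rewrite pmulr_rle0.
  by rewrite subr_ge0.
apply: proper_card; apply/properP; split.
  apply/fintype.subsetP => i; rewrite !inE; apply: contra => ti.
  by rewrite /tight tE (vt _ ti) mulr0 addr0.
exists i0; rewrite !inE // negbK /tight tE /r divfK; last by rewrite gt_eqF.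
by rewrite addrC subrK.
Qed.

(* The induction behind Minkowski's theorem: a non-vertex lies strictly between
   two points that have more tight constraints. *)
Lemma polytope_ind (Q : 'rV[F]_m -> Prop) : convex_pred Q ->
  (forall s, sol s -> vertex s -> Q s) -> forall s, sol s -> Q s.
Proof.
move=> cQ vQ s; have [k] := ubnP #|[pred i | ~~ tight s i]|.
elim: k => // k IH in s * => sk ss.
have [vs|] := pselect (vertex s); first exact: vQ.
move=> /existsNP[v /not_implyP[vt /eqP v0]].
have [t [t0 st ct]] := sol_exit ss v0 vt.
have [||t' [t0' st' ct']] := sol_exit (v := - v) ss.
- by rewrite oppr_eq0.
- by move=> i /vt; rewrite dotN => ->; rewrite oppr0.
have tt0 : 0 < t + t' by rewrite addr_gt0.
have -> : s = (t' / (t + t')) *: (s + t *: v) + (1 - t' / (t + t')) *: (s + t' *: - v).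
  apply/rowP => j; rewrite !mxE; field; lra.
apply: cQ; [exact: (IH _ (leq_trans ct sk))|exact: (IH _ (leq_trans ct' sk))|].
by rewrite divr_gt0 //= ltr_pdivrMr // mul1r ltrDr.
Qed.

End Polytope.

Lemma det_norm_le m (G : 'M[int]_m) (M : nat) :
  (forall i j, `|G i j| <= M%:Z) -> `|\det G| <= (m`! * M ^ m)%N%:Z.
Proof.
move=> GM; apply: (le_trans (ler_norm_sum _ _ _)).
have -> : (m`! * M ^ m)%N%:Z = \sum_(s : 'S_m) (M ^ m)%N%:Z.
  by rewrite sumr_const card_Sn -mulr_natl natz PoszM.
apply: ler_sum => s _; rewrite normrMsign normr_prod.
rewrite -[X in (_ ^ X)%N](card_ord m) -prod_nat_const -natz natr_prod.
by apply: ler_prod => i _; rewrite normr_ge0 natz GM.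
Qed.

(** Some [m] tight rows form an invertible integer matrix [G]. Multiplying its system by the
    adjugate shows that [\det G] times [s] is integral; [D] is the absolute value of the
    determinant, its sign being moved to the numerators. *)
Lemma vertex_coord (R : realFieldType) m (I : finType) (A : I -> 'I_m -> int)
    (B : I -> int) (M : nat) (s : 'rV[R]_m) :
  (forall i j, `|A i j| <= M%:Z) ->
  vertex (fun i j => (A i j)%:~R) (fun i => (B i)%:~R) s ->
  exists2 D, (0 < D <= m`! * M ^ m)%N &
    forall j, exists z : int, s 0 j = z%:~R / D%:R.
Proof.
move=> AM vs; pose T := [set i | tight (fun i j => (A i j)%:~R) (fun i => (B i)%:~R) s i].
pose Am : 'M[int]_(#|T|, m) := \matrix_(i, j) A (enum_val i) j.
pose AR : 'M[R]_(#|T|, m) := map_mx intr Am.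
have fA : row_full AR.
  rewrite -[row_full _]/(\rank AR == m) -mxrank_tr.
  apply/row_freeP; apply/row_freeP/inj_row_free => v vA; apply: vs => i ti.
  have iT : i \in T by rewrite inE.
  move/rowP/(_ (enum_rank_in iT i)): vA; rewrite !mxE => <-.
  by apply: eq_bigr => j _; rewrite !mxE enum_rankK_in // mulrC.
pose f := fullrankfun fA; pose G := rowsub f Am.
have GR : rowsub f AR = map_mx intr G by apply/matrixP => i j; rewrite !mxE.
have := fullrowsub_unit fA; rewrite -/f GR unitmxE unitfE det_map_mx intr_eq0 => dG.
pose bz : 'cV[int]_m := \col_i B (enum_val (f i)).
have Gs : map_mx intr G *m s^T = map_mx intr bz.
  apply/colP => i; rewrite !mxE.
  have /[!inE]/eqP <- := enum_valP (f i).
  by apply: eq_bigr => j _; rewrite !mxE.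
have ds : (\det G)%:~R *: s^T = map_mx (intr : int -> R) (\adj G *m bz).
  by rewrite map_mxM -Gs mulmxA -map_mxM mul_adj_mx map_scalar_mx mul_scalar_mx.
exists `|\det G|%N.
  by rewrite absz_gt0 dG -lez_nat abszE det_norm_le // => i j; rewrite !mxE.
move=> j; exists (sgz (\det G) * (\adj G *m bz) j 0).
have /matrixP/(_ j 0) := ds; rewrite [LHS]mxE [s^T _ _]mxE [RHS]mxE => E.
apply: (canRL (mulfK _)); first by rewrite pnatr_eq0 absz_eq0.
by rewrite -[_%:R]/(`|\det G|%N%:Z%:~R) abszEsg mulrC !rmorphM /= -mulrA E.
Qed.

(** * Certificates of membership *)

Lemma poly_nonroot (F : numFieldType) (P : {poly F}) : P != 0 -> exists x, P.[x] != 0.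
Proof.
move=> P0; pose rs : seq F := [seq i%:R | i <- iota 0 (size P)].
have [/allP H|/allPn[x _ Px]] := boolP (all (root P) rs); last by exists x.
have := max_poly_roots P0 (introT allP H).
rewrite map_inj_uniq ?iota_uniq => [/(_ isT)|i j /eqP]; last by rewrite eqr_nat => /eqP.
by rewrite size_map size_iota ltnn.
Qed.

(** Rank is lower semicontinuous, here in algebraic form: with [L] and [R] such that [L N R] is the
    identity of size [\rank N], the polynomial is the determinant of [L (N + x N') R], which is 1 at
    0. *)
Lemma mxrank_perturb (F : fieldType) a b (N N' : 'M[F]_(a, b)) :
  exists2 P : {poly F}, P.[0] != 0 &
    forall x, P.[x] != 0 -> (\rank N <= \rank (N + x *: N')%R)%N.
Proof.
have /row_fullP[L LC] := col_base_full N; have /row_freeP[R CR] := row_base_free N.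
pose Z := L *m N' *m R; pose P := \det (1%:M + 'X *: map_mx polyC Z).
have PE x : P.[x] = \det (1%:M + x *: Z).
  rewrite -horner_evalE -det_map_mx; congr (\det _); apply/matrixP => i j.
  by rewrite !mxE /= horner_evalE !hornerE; case: eqP; rewrite ?hornerC.
exists P; first by rewrite PE scale0r addr0 det1 oner_neq0.
move=> x; rewrite PE => u.
have E : 1%:M + x *: Z = L *m (N + x *: N') *m R.
  rewrite mulmxDr mulmxDl -!(scalemxAr, scalemxAl); congr (_ + _).
  have -> : L *m N = row_base N by rewrite -[RHS]mul1mx -LC -mulmxA mulmx_base.
  by rewrite CR.
have /mxrank_unit <- : 1%:M + x *: Z \in unitmx by rewrite unitmxE unitfE.
rewrite E (leq_trans (mxrankM_maxl (L *m (N + x *: N')) R)) //.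
exact: mxrankM_maxr.
Qed.

Section Certificates.
Variables (n m : nat) (d : 'I_m -> nat) (phi : forall j, 'M[rat]_(n, d j)).

(* Row spaces of matrices represent subspaces. For [K <= V] this is a certificate
   for the datum induced on [V / K], whose targets are the quotients by the images
   of [K]. *)
Definition cert_mx (K V : 'M[rat]_n) p q (A : forall j : 'I_m, 'M[rat]_(p j, q)) :=
  forall X : 'M_(q, n), (X <= V)%MS ->
    (forall j, A j *m X *m phi j <= K *m phi j)%MS -> (X <= K)%MS.
Definition cert K V p q := exists A, @cert_mx K V p q A.

Lemma cert_add K V p q p' q' : cert K V p q -> cert K V p' q' ->
  cert K V (fun j => p j + p' j)%N (q + q').
Proof.
move=> [A cA] [B cB]; exists (fun j => block_mx (A j) 0 0 (B j)) => X.
rewrite -(vsubmxK X) col_mx_sub => /andP[XV XV'] H.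
have {}H j : (A j *m usubmx X *m phi j <= K *m phi j)%MS &&
    (B j *m dsubmx X *m phi j <= K *m phi j)%MS.
  by have := H j; rewrite mul_block_col !mul0mx addr0 add0r mul_col_mx col_mx_sub.
by rewrite col_mx_sub cA ?cB // => j; have /andP[] := H j.
Qed.

Lemma cert_scale K V p q k : cert K V p q -> (0 < k)%N ->
  cert K V (fun j => k * p j)%N (k * q).
Proof.
move=> c; elim: k => // -[_ _|k IH _].
  rewrite mul1n; suff -> : (fun j => 1 * p j)%N = p by [].
  by apply/funext => j; rewrite mul1n.
rewrite mulSn; exact: cert_add c (IH isT).
Qed.

(* The linear map whose kernel is the space of the [X] in the definition of
   [cert_mx]; it is affine in [A], hence the genericity of certificates. *)
Definition cert_mat (K V : 'M[rat]_n) p q (A : forall j : 'I_m, 'M[rat]_(p j, q)) :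
    'M[rat]_(q * n, q * n + \sum_j p j * d j) :=
  row_mx (lin_mulmxr (cokermx V))
    (\mxrow_j (lin_mulmx (A j) *m lin_mulmxr (phi j *m cokermx (K *m phi j)))).

Lemma cert_matP K V p q (A : forall j : 'I_m, 'M[rat]_(p j, q)) X :
  reflect ((X <= V)%MS /\ forall j, (A j *m X *m phi j <= K *m phi j)%MS)
    (mxvec X *m cert_mat K V A == 0).
Proof.
have E j (B : 'M_(n, d j)) : mxvec X *m (lin_mulmx (A j) *m lin_mulmxr B) =
    mxvec (A j *m X *m B).
  by rewrite mulmxA /lin_mulmx /lin_mulmxr !mul_vec_lin.
rewrite /cert_mat mul_mx_row row_mx_eq0 mul_vec_lin /= mxvec_eq0 -submxE mul_mxrow.
apply: (iffP andP) => -[XV H]; split=> //.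
  move=> j; move/eqP/(congr1 (fun M => submxrow M j)): H.
  rewrite mxrowK E submxE -mxvec_eq0 !mulmxA => ->.
  by apply/eqP/rowP => k; rewrite !mxE.
apply/eqP; rewrite -[RHS]mxrow0; apply/eq_mxrow => j; rewrite E; apply/eqP.
by rewrite mxvec_eq0 mulmxA -submxE.
Qed.

(** Every [X] with rows in [K] lies in the kernel of [cert_mat]. Being a certificate is the opposite
    inclusion of kernels, hence a lower bound on a rank, a condition that survives generic
    perturbation. *)
Lemma cert_mx_rank K V p q (A : forall j : 'I_m, 'M[rat]_(p j, q)) : (K <= V)%MS ->
  (cert_mx K V A <->
    (\rank (lin_mulmxr (cokermx K) : 'M_(q * n)) <= \rank (cert_mat K V A))%N).
Proof.
move=> KV; set NK : 'M_(q * n) := lin_mulmxr _; set NA := cert_mat K V A.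
have NKP X : (mxvec X *m NK == 0) = (X <= K)%MS.
  by rewrite mul_vec_lin /= mxvec_eq0 -submxE.
have sub : (kermx NK <= kermx NA)%MS.
  apply/rV_subP => v; rewrite !sub_kermx -(vec_mxK v) NKP => XK.
  apply/cert_matP; split; first exact: submx_trans KV.
  by move=> j; rewrite submxMr // mulmx_sub.
have -> : cert_mx K V A <-> (kermx NA <= kermx NK)%MS.
  split=> [cA|/rV_subP H X XV XK].
    apply/rV_subP => v; rewrite !sub_kermx -(vec_mxK v) NKP => /cert_matP[XV XK].
    exact: cA.
  rewrite -NKP -sub_kermx; apply: H; rewrite sub_kermx.
  by apply/cert_matP.
have rk := mxrank_ker; have /= := mxrankS sub.
rewrite !rk => le1; split=> [/mxrankS|le2].
  rewrite !rk; have := rank_leq_row NA; have := rank_leq_row NK; lia.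
have : (kermx NK == kermx NA)%MS.
  have [_ <-] := mxrank_leqif_eq sub; rewrite !rk.
  by rewrite eqn_leq le1 leq_sub2l.
by case/andP.
Qed.

Lemma cert_mat_perturb K V p q (A B : forall j : 'I_m, 'M[rat]_(p j, q)) :
  exists N, forall x, cert_mat K V (fun j => A j + x *: B j) = cert_mat K V A + x *: N.
Proof.
exists (row_mx 0 (\mxrow_j (lin_mulmx (B j) *m lin_mulmxr (phi j *m cokermx (K *m phi j))))).
move=> x; rewrite /cert_mat scale_row_mx add_row_mx scaler0 addr0; congr row_mx.
rewrite -mul_scalar_mx mul_mxrow -mxrowD; apply/eq_mxrow => j.
by rewrite mul_scalar_mx linearD linearZ /= mulmxDl scalemxAl.
Qed.

(** On the line from [A] to [B] the first property holds at 0 and the second at 1, so each fails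
    only at the zeros of a nonzero polynomial; some [t] avoids both. A common certificate then first
    forces [X] into [W] and next into [K]. *)
Lemma cert_trans (K W V : 'M_n) p q : (K <= W)%MS -> (W <= V)%MS ->
  cert K W p q -> cert W V p q -> cert K V p q.
Proof.
move=> KW WV [A /cert_mx_rank cA] [B /cert_mx_rank cB].
have [N NE] := cert_mat_perturb K W A (fun j => B j - A j).
have [N' NE'] := cert_mat_perturb W V B (fun j => A j - B j).
have [P P0 PN] := mxrank_perturb (cert_mat K W A) N.
have [P' P0' PN'] := mxrank_perturb (cert_mat W V B) N'.
have /poly_nonroot[t] : P * (P' \Po (1 - 'X)) != 0.
  rewrite mulf_neq0 //; first by apply: contra_neq P0 => ->; rewrite hornerE.
  apply: contra_neq P0' => /(congr1 (horner^~ 1)).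
  by rewrite horner_comp !hornerE subrr.
rewrite hornerM horner_comp !hornerE mulf_eq0 negb_or => /andP[/PN le1 /PN' le2].
pose C j := A j + t *: (B j - A j).
exists C => X XV XK.
have C1 : cert_mx K W C.
  by apply/cert_mx_rank => //; rewrite NE; exact: leq_trans (cA KW) le1.
have C2 : cert_mx W V C.
  apply/cert_mx_rank => //.
  have -> : C = fun j => B j + (1 - t) *: (A j - B j).
    apply/functional_extensionality_dep => j; rewrite /C.
    by apply/matrixP => i k; rewrite !mxE; ring.
  by rewrite NE'; exact: leq_trans (cB WV) le2.
apply: C1 => //; apply: C2 => // j.
by apply: submx_trans (XK j) _; exact: submxMr.
Qed.

(** The [X] with rows in the row space of [U] are the [v U'], with [U'] a basis. Factoring
    [U' phi_j] as [C_j] times a row basis of full rank shows that the map from [v] to the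
    [A_j v C_j] is injective; the inequality compares the dimensions of its source and target. *)
Lemma cert_soundness p q : cert 0 1%:M p q -> forall k (U : 'M_(k, n)),
  (q * \rank U <= \sum_j p j * \rank (U *m phi j))%N.
Proof.
move=> [A cA] k U; pose r := \rank U; pose U' := row_base U.
have rE j : \rank (U' *m phi j) = \rank (U *m phi j).
  by rewrite (eqmxMr (phi j) (eq_row_base U)).
pose C j : 'M_(r, \rank (U' *m phi j)) := col_base (U' *m phi j).
pose N : 'M_(q * r, \sum_j p j * \rank (U' *m phi j)) :=
  \mxrow_j (lin_mulmx (A j) *m lin_mulmxr (C j)).
have -> : (\sum_j p j * \rank (U *m phi j) = \sum_j p j * \rank (U' *m phi j))%N.
  by apply: eq_bigr => j _; rewrite rE.
suff /eqP <- : row_free N by exact: rank_leq_col.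
apply: inj_row_free => v vN.
have vj j : A j *m vec_mx v *m C j = 0.
  move: vN; rewrite -{1}(vec_mxK v) mul_mxrow => /(congr1 (fun M => submxrow M j)).
  rewrite mxrowK mulmxA /lin_mulmx /lin_mulmxr !mul_vec_lin /= => H.
  apply: (can_inj mxvecK); rewrite H linear0; apply/rowP => i; by rewrite !mxE.
have : (vec_mx v *m U' <= (0 : 'M_n))%MS.
  apply: cA; first exact: submx1.
  move=> j; have -> : A j *m (vec_mx v *m U') *m phi j =
      A j *m vec_mx v *m (U' *m phi j) by rewrite !mulmxA.
  by rewrite -(mulmx_base (U' *m phi j)) mulmxA vj !mul0mx sub0mx.
rewrite submx0 mulmx_free_eq0 ?row_base_free // => /eqP v0.
by rewrite -(vec_mxK v) v0 linear0.
Qed.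

End Certificates.

(** * Polytopes of subquotients *)

Lemma dist_nat_le (a b c : nat) : (a <= c)%N -> (b <= c)%N -> `|a%:Z - b%:Z| <= c.+1%:Z.
Proof. lia. Qed.

Section IntervalPolytope.
Variables (n m : nat) (d : 'I_m -> nat) (phi : forall j, 'M[rat]_(n, d j)).
Implicit Types K V W : 'M[rat]_n.

(** The polytope of the datum induced on [V / K]: its subspaces are the [W] between [K] and [V], and
    dimensions of quotients are differences of ranks. *)
Definition in_poly (F : realFieldType) K V (s : 'rV[F]_m) :=
  (forall j, 0 <= s 0 j <= 1) /\
  forall W, (K <= W)%MS -> (W <= V)%MS ->
    (\rank W)%:R - (\rank K)%:R <=
      \sum_j s 0 j * ((\rank (W *m phi j))%:R - (\rank (K *m phi j))%:R) :> F.

(* The second component indexes the possible values of the ranks of [W] and of its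
   images. *)
Definition constraint : finType :=
  (('I_m * bool) + ({ffun 'I_m -> 'I_n.+1} * 'I_n.+1))%type.

Definition realized K V (fe : {ffun 'I_m -> 'I_n.+1} * 'I_n.+1) W :=
  [/\ (K <= W)%MS, (W <= V)%MS, \rank W = fe.2 &
      forall j, \rank (W *m phi j) = fe.1 j].

(** Rank vectors that are not realized give the vacuous constraint 0 <= 0. Realizability is decided
    by classical logic and enters the proof only, never the algorithm. Signs are reversed to bring
    the rank inequalities into the form [<=]. *)
Definition lhs K V (i : constraint) (j : 'I_m) : int :=
  match i with
  | inl (k, c) => if j == k then (if c then 1 else -1) else 0
  | inr fe => if `[< exists W, realized K V fe W >]
              then (\rank (K *m phi j))%:Z - (fe.1 j : nat)%:Z else 0
  end.

Definition rhs K V (i : constraint) : int :=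
  match i with
  | inl (k, c) => if c then 1 else 0
  | inr fe => if `[< exists W, realized K V fe W >]
              then (\rank K)%:Z - (fe.2 : nat)%:Z else 0
  end.

Lemma realizedP K V W : (K <= W)%MS -> (W <= V)%MS -> exists fe, realized K V fe W.
Proof.
move=> KW WV; have rW j : (\rank (W *m phi j) < n.+1)%N.
  by rewrite ltnS (leq_trans (mxrankM_maxl _ _)) ?rank_leq_col.
have rW' : (\rank W < n.+1)%N by rewrite ltnS rank_leq_col.
exists ([ffun j => Ordinal (rW j)], Ordinal rW').
by split => // j; rewrite ffunE.
Qed.

Lemma norm_lhs K V i j : `|lhs K V i j| <= n.+1%:Z.
Proof.
have rK : (\rank (K *m phi j) <= n)%N by rewrite (leq_trans (mxrankM_maxl _ _)) ?rank_leq_col.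
case: i => [[k c]|fe] /=; first by case: eqP => _; case: c; lia.
by case: asboolP => _ //; apply: dist_nat_le; rewrite // -ltnS.
Qed.

Lemma norm_rhs K V i : `|rhs K V i| <= n.+1%:Z.
Proof.
have rK := rank_leq_col K.
case: i => [[k c]|fe] /=; first by case: c; lia.
by case: asboolP => _ //; apply: dist_nat_le; rewrite // -ltnS.
Qed.

Section Field.
Variable F : realFieldType.
Implicit Types (s v : 'rV[F]_m).
Let A K V i j : F := (lhs K V i j)%:~R.
Let B K V i : F := (rhs K V i)%:~R.

Lemma dot_box K V (k : 'I_m) (c : bool) v :
  dot (A K V (inl (k, c))) v = if c then v 0 k else - v 0 k.
Proof.
rewrite /dot (bigD1 k) //= big1 ?addr0 => [|j /negPf jk]; rewrite /A /=.
  by rewrite eqxx; case: c; rewrite ?mul1r ?mulN1r.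
by rewrite jk mul0r.
Qed.

Lemma dot_rank K V fe W v : realized K V fe W ->
  dot (A K V (inr fe)) v =
   - \sum_j v 0 j * ((\rank (W *m phi j))%:R - (\rank (K *m phi j))%:R).
Proof.
move=> rW; rewrite /dot -sumrN; apply: eq_bigr => j _; rewrite /A /=.
have -> : `[< exists W, realized K V fe W >] by apply/asboolP; exists W.
case: rW => _ _ _ ->; rewrite rmorphB /= -!pmulrn; ring.
Qed.

Lemma rhs_rank K V fe W : realized K V fe W ->
  B K V (inr fe) = - ((\rank W)%:R - (\rank K)%:R).
Proof.
move=> rW; rewrite /B /=.
have -> : `[< exists W, realized K V fe W >] by apply/asboolP; exists W.
case: rW => _ _ -> _; rewrite rmorphB /= -!pmulrn; ring.
Qed.

Lemma sol_in_poly K V s : sol (A K V) (B K V) s <-> in_poly K V s.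
Proof.
split=> [ss|[box sP]].
  split=> [j|W KW WV].
    have := ss (inl (j, true)); have := ss (inl (j, false)).
    by rewrite !dot_box /B /= oppr_le0 => -> ->.
  have [fe rW] := realizedP KW WV.
  by have := ss (inr fe); rewrite (dot_rank _ rW) (rhs_rank rW) lerN2.
case=> [[k c]|fe].
  by rewrite dot_box /B /=; case: c; have /andP[? ?] := box k; rewrite ?oppr_le0.
have [[W rW]|nW] := pselect (exists W, realized K V fe W).
  by rewrite (dot_rank _ rW) (rhs_rank rW) lerN2; case: rW => ? ? *; exact: sP.
rewrite /dot /A /B /= asboolF //= big1 // => j _; by rewrite mul0r.
Qed.

Lemma bounded_poly K V v : v != 0 -> exists i, 0 < dot (A K V i) v.
Proof.
move=> v0; have [j vj] : exists j, v 0 j != 0.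
  apply: contra_notP (elimN eqP v0) => /forallNP H.
  by apply/rowP => j; rewrite mxE; have /negP/negPn/eqP := H j.
case: (ltrgtP (v 0 j) 0) vj => // [lt|gt] _.
  by exists (inl (j, false)); rewrite dot_box oppr_gt0.
by exists (inl (j, true)); rewrite dot_box.
Qed.

Definition fractional s j := (0 < s 0 j < 1).

(* At a vertex without a proper tight subspace, two fractional coordinates could be
   traded against each other along the only remaining constraint, that of [V]. *)
Lemma vertex_fractional K V s : in_poly K V s -> vertex (A K V) (B K V) s ->
  (forall W, (K <= W)%MS -> (W <= V)%MS ->
     (\rank W)%:R - (\rank K)%:R =
       \sum_j s 0 j * ((\rank (W *m phi j))%:R - (\rank (K *m phi j))%:R) :> F ->
     (W <= K)%MS \/ (V <= W)%MS) ->
  forall j k, fractional s j -> fractional s k -> j = k.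
Proof.
move=> [box sP] vs crit j k fj fk; apply/eqP; apply: contraT => jk.
pose D i : F := (\rank (V *m phi i))%:R - (\rank (K *m phi i))%:R.
suff [v [v0 vjk vD]] : exists v : 'rV[F]_m, [/\ v != 0,
    forall i, i != j -> i != k -> v 0 i = 0 & \sum_i v 0 i * D i = 0].
  suff /vs v0' : forall i, tight (A K V) (B K V) s i -> dot (A K V i) v = 0.
    by rewrite v0' eqxx in v0.
  case=> [[i c]|fe].
    rewrite /tight !dot_box /B /= => ti.
    (* A box constraint tight at [s] involves neither [j] nor [k], as these coordinates are
       fractional, and [v] vanishes elsewhere. *)
    suff -> : v 0 i = 0 by case: (c); rewrite ?oppr0.
    have [/andP[sj sj'] /andP[sk sk']] := (fj, fk).
    apply: vjk; apply: contraTneq ti => ->; case: (c).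
    - by rewrite lt_eqF.
    - by rewrite oppr_eq0 gt_eqF.
    - by rewrite lt_eqF.
    - by rewrite oppr_eq0 gt_eqF.
  have [[W rW]|nW] := pselect (exists W, realized K V fe W); last first.
    by move=> _; rewrite /dot /A /= asboolF //= big1 // => i _; rewrite mul0r.
  rewrite /tight !(dot_rank _ rW) (rhs_rank rW) eqr_opp => /eqP/esym tW.
  have [KW WV _ _] := rW; apply/eqP; rewrite oppr_eq0; apply/eqP.
  case: (crit W KW WV tW) => sub.
    apply: big1 => i _; have /eqmxMr -> : (W :=: K)%MS by apply/eqmxP; rewrite sub.
    by rewrite subrr mulr0.
  rewrite -[RHS]vD; apply: eq_bigr => i _.
  by have /eqmxMr -> : (W :=: V)%MS by apply/eqmxP; rewrite sub WV.
(* A nonzero vector supported on [j] and [k] and orthogonal to [D] is the unit vector at [j], or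
   else the pair [(D k, - D j)]. *)
have [Dj|Dj] := eqVneq (D j) 0.
  exists (delta_mx 0 j); split.
  - by apply/eqP => /rowP/(_ j)/eqP; rewrite !mxE !eqxx oner_eq0.
  - by move=> i /negPf ij _; rewrite mxE ij andbF.
  rewrite (bigD1 j) //= Dj mulr0 add0r big1 // => i /negPf ij.
  by rewrite mxE ij andbF mul0r.
exists (D k *: delta_mx 0 j - D j *: delta_mx 0 k); split.
- apply/eqP => /rowP/(_ k)/eqP; rewrite !mxE !eqxx (eq_sym k) (negPf jk) /= mulr0 sub0r.
  by rewrite mulr1 oppr_eq0 (negPf Dj).
- by move=> i /negPf ij /negPf ik; rewrite !mxE ij ik /= !mulr0 subr0.
rewrite (bigD1 j) //= (bigD1 k) 1?eq_sym //= big1 => [|i /andP[/negPf ij /negPf ik]].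
  by rewrite !mxE !eqxx (negPf jk) (eq_sym k) (negPf jk) /=; ring.
by rewrite !mxE ij ik /= !mulr0 subr0 mul0r.
Qed.
End Field.
End IntervalPolytope.

(** * Existence of certificates *)

(** Here [w], [k] are the ranks of [W], [K] and [w'], [k'] those of their images. A map does not
    increase relative dimension, so an inequality with a factor below 1 forces relative dimension
    0. *)
Lemma contraction_le (F : realFieldType) (s w w' k k' : F) : 0 < s -> s < 1 ->
  w' + k <= w + k' -> k' <= w' -> k <= w -> w - k <= s * (w' - k') -> w <= k.
Proof. by move=> *; nra. Qed.

Section Completeness.
Variables (n m : nat) (d : 'I_m -> nat) (phi : forall j, 'M[rat]_(n, d j)).
Implicit Types K V W : 'M[rat]_n.

Definition certified K V (s : 'rV[rat]_m) := exists q p,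
  [/\ (0 < q)%N, cert phi K V p q & forall j, (p j)%:R = s 0 j * q%:R :> rat].

(** For [t = a / (a + b)], the block sum takes [a * q'] copies of the first certificate and [b * q]
    copies of the second, so that their column numbers are in the ratio [a : b]. *)
Lemma certified_convex K V : convex_pred (certified K V).
Proof.
move=> x y t [q [p [q0 c px]]] [q' [p' [q0' c' py]]] /andP[t0 t1].
have [a [b [a0 b0 tE]]] : exists a b : nat, [/\ (0 < a)%N, (0 < b)%N & t = a%:R / (a + b)%:R].
  have dt := denq_gt0 t; have nt : 0 < numq t by rewrite numq_gt0.
  have nd : numq t < denq t.
    by move: t1; rewrite -{1}(divq_num_den t) ltr_pdivrMr ?ltr0z // mul1r ltr_int.
  exists `|numq t|%N, `|denq t - numq t|%N; split; [lia|lia|].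
  rewrite -{1}(divq_num_den t) pmulrn pmulrn; congr (_%:~R / _%:~R); lia.
have ab0 : (a + b)%:R != 0 :> rat by rewrite pnatr_eq0 -lt0n addn_gt0 a0.
exists (a * q' * q + b * q * q')%N, (fun j => a * q' * p j + b * q * p' j)%N; split.
- by rewrite addn_gt0 !muln_gt0 a0 q0 q0'.
- by apply: cert_add; apply: cert_scale => //; rewrite muln_gt0 ?a0 ?b0 ?q0 ?q0'.
- move=> j; rewrite !mxE tE !natrD !natrM px py; field.
  by rewrite -natrD.
Qed.

(** Both certificates are scaled to [q * q'] columns; their row numbers then agree, being [s 0 j]
    times that number. *)
Lemma certified_trans K W V s : (K <= W)%MS -> (W <= V)%MS ->
  certified K W s -> certified W V s -> certified K V s.
Proof.
move=> KW WV [q [p [q0 c ps]]] [q' [p' [q0' c' ps']]].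
exists (q' * q)%N, (fun j => q' * p j)%N; split.
- by rewrite muln_gt0 q0 q0'.
- apply: (cert_trans KW WV); first exact: cert_scale.
  have -> : (fun j => q' * p j)%N = (fun j => q * p' j)%N.
    apply/funext => j; apply/eqP; rewrite -(eqr_nat rat) !natrM ps ps'.
    by rewrite mulrCA [X in _ == X]mulrCA [q%:R * _]mulrC.
  by rewrite mulnC; exact: cert_scale.
- by move=> j; rewrite !natrM ps mulrCA.
Qed.

(** [W] is spanned by [K] and a complement of [K], whose image has no larger dimension. *)
Lemma mxrank_image_sub k (K W : 'M[rat]_n) (f : 'M[rat]_(n, k)) : (K <= W)%MS ->
  (\rank (W *m f) + \rank K <= \rank W + \rank (K *m f))%N.
Proof.
move=> KW; have WE : (W <= K + (W :\: K))%MS.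
  have /eqmxP/andP[_ h] := addsmx_diff_cap_eq W K.
  apply: submx_trans h _; rewrite addsmx_sub addsmxSr.
  by rewrite (submx_trans (capmxSr W K)) // addsmxSl.
have := mxrankS (submxMr f WE); rewrite (addsmxMr K _ f).
have := mxrank_adds_leqif (K *m f) ((W :\: K)%MS *m f) => -[+ _].
have := mxrankM_maxl (W :\: K)%MS f.
have := mxrank_cap_compl W K.
have -> : \rank (W :&: K) = \rank K.
  by apply/eqP; rewrite eqn_leq mxrankS ?capmxSr //= mxrankS // sub_capmx KW submx_refl.
move=> <- H1 H2 H3; rewrite addnC -addnA leq_add2l (leq_trans H3) // (leq_trans H2) //.
by rewrite addnC leq_add2r.
Qed.

(** [W] is the largest subspace of [V] that [phi j] maps into the image of [K] whenever [s 0 j] is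
    1. In its inequality the terms at coordinates 0 and 1 vanish, so at most one term with a factor
    below 1 remains, and [W] equals [K]. Where [s 0 j] is 1, [pid_mx q] is the identity; hence every
    [X] annihilated modulo [K] has its rows in [W]. *)
Lemma certified_base K V s : (K <= V)%MS -> in_poly phi K V s ->
  (forall j k, fractional s j -> fractional s k -> j = k) -> certified K V s.
Proof.
move=> KV [box sP] frac.
pose G j := kermx (phi j *m cokermx (K *m phi j)).
have GP (j : 'I_m) k (X : 'M_(k, n)) : (X <= G j)%MS = (X *m phi j <= K *m phi j)%MS.
  by rewrite sub_kermx submxE mulmxA.
pose W := (V :&: \bigcap_(j < m | s 0 j == 1) G j)%MS.
have KW : (K <= W)%MS.
  by rewrite sub_capmx KV; apply/sub_bigcapmxP => j _; rewrite GP.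
have WV : (W <= V)%MS by exact: capmxSl.
have WG j : s 0 j = 1 -> \rank (W *m phi j) = \rank (K *m phi j).
  move=> sj; apply/eqP; rewrite eqn_leq [X in _ && X]mxrankS ?submxMr // andbT.
  apply: mxrankS; rewrite -GP (submx_trans (capmxSr _ _)) //.
  by apply: (@bigcapmx_inf _ _ j); rewrite ?sj.
have term0 j : ~~ fractional s j ->
    s 0 j * ((\rank (W *m phi j))%:R - (\rank (K *m phi j))%:R) = 0.
  move=> nf; have [/WG ->|s1] := eqVneq (s 0 j) 1; first by rewrite subrr mulr0.
  have /andP[s0 s1'] := box j; suff -> : s 0 j = 0 by rewrite mul0r.
  apply: contraNeq nf => s0'; rewrite /fractional lt_neqAle eq_sym s0' s0.
  by rewrite lt_neqAle s1 s1'.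
have rKW : (\rank K <= \rank W)%N by exact: mxrankS.
have WK : (W <= K)%MS.
  suff : (\rank W <= \rank K)%N.
    by rewrite -(geq_leqif (mxrank_leqif_sup KW)).
  have := sP W KW WV; have [[j fj]|nf] := pselect (exists j, fractional s j); last first.
    rewrite big1 => [|j _]; last by apply: term0; apply/negP => fj; apply: nf; exists j.
    by rewrite subr_le0 ler_nat.
  rewrite (bigD1 j) //= big1 ?addr0 => [|k kj]; last first.
    by apply: term0; apply: contra kj => fk; rewrite (frac _ _ fk fj).
  have /andP[sj0 sj1] := fj.
  have := mxrank_image_sub (phi j) KW; rewrite -(ler_nat rat) !natrD => le1.
  have le2 : (\rank (K *m phi j) <= \rank (W *m phi j))%N by rewrite mxrankS ?submxMr.
  move: rKW le2; rewrite -!(ler_nat rat) => le3 le2.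
  exact: contraction_le sj0 sj1 le1 le2 le3.
pose t j := s 0 j; pose q := (\prod_j `|denq (t j)|)%N.
have q0 : (0 < q)%N by apply: prodn_gt0 => j; rewrite absz_gt0 denq_neq0.
have /fin_all_exists[p pE] : forall j, exists p : nat, p%:R = t j * q%:R.
  move=> j; have /andP[t0 _] : 0 <= t j <= 1 := box j; rewrite /q (bigD1 j) //=.
  set c := (\prod_(_ < _ | _) _)%N.
  exists (`|numq (t j)| * c)%N.
  rewrite !natrM mulrA; congr (_ * _); rewrite !natr_absz !ger0_norm ?numq_ge0 //.
  by rewrite -{2}(divq_num_den (t j)) divfK ?intr_eq0.
exists q, p; split => //; exists (fun j => pid_mx q) => X XV XK.
apply: submx_trans WK; rewrite sub_capmx XV; apply/sub_bigcapmxP => j /eqP sj.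
rewrite GP; have /row_fullP[L LE] : row_full (pid_mx q : 'M[rat]_(p j, q)).
  have := pE j; rewrite /t sj mul1r => /eqP; rewrite eqr_nat => /eqP ->.
  by rewrite /row_full rank_pid_mx.
rewrite -[X]mul1mx -LE -!mulmxA; apply: submx_trans (submxMl _ _) _.
by rewrite mulmxA.
Qed.

Lemma certified_complete K V s : (K <= V)%MS -> in_poly phi K V s -> certified K V s.
Proof.
have [k] := ubnP (\rank V - \rank K); elim: k => // k IH in K V s *.
rewrite ltnS => VKk KV /sol_in_poly.
move: s; apply: polytope_ind (certified_convex (K := K) (V := V)) _.
  exact: bounded_poly.
move=> s /sol_in_poly sP vs.
have [[W [KW WV crit nWK nVW]]|ncrit] := pselect (exists W, [/\ (K <= W)%MS, (W <= V)%MS,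
    (\rank W)%:R - (\rank K)%:R =
      \sum_j s 0 j * ((\rank (W *m phi j))%:R - (\rank (K *m phi j))%:R) :> rat,
    ~~ (W <= K)%MS & ~~ (V <= W)%MS]); last first.
  apply: certified_base => //; apply: (vertex_fractional sP vs) => W KW WV crit.
  apply/orP; apply: contra_notT ncrit; rewrite negb_or => /andP[? ?].
  by exists W.
have [box sub] := sP.
have ltKW : (\rank K < \rank W)%N.
  by rewrite ltn_neqAle mxrankS // andbT (mxrank_leqif_sup KW).
have ltWV : (\rank W < \rank V)%N.
  by rewrite ltn_neqAle mxrankS // andbT (mxrank_leqif_sup WV).
apply: (certified_trans KW WV); apply: IH => //; try lia.
  by split=> // U KU UW; apply: sub => //; exact: submx_trans WV.
split=> // U WU UV; have := sub U (submx_trans KW WU) UV.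
(* Subtracting the equality at the tight [W] from the inequality of [U] over [K] gives that of [U]
   over [W]. *)
rewrite -(lerD2r (- ((\rank W)%:R - (\rank K)%:R))) {2}crit -sumrB.
rewrite opprB addrA subrK => /le_trans; apply; rewrite le_eqVlt; apply/orP; left.
by apply/eqP; apply: eq_bigr => j _; ring.
Qed.
End Completeness.

(** * Correctness of the coded certificates *)

Lemma extend_along (T : finType) (U : nmodType) (g : T -> nat) (F : T -> U) :
  injective g -> exists f : nat -> U, forall t, f (g t) = F t.
Proof.
move=> ginj; exists (fun x => oapp F 0 [pick t | g t == x]) => t.
by case: pickP => [u /eqP/ginj -> //|/(_ t)]; rewrite eqxx.
Qed.

Lemma has_table_on (T : finType) (g : T -> nat) (F : T -> rat) : injective g ->
  exists c0, forall c (Phi : (nat -> rat) -> bool), (c0 <= c)%N ->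
    (forall h, (forall t, h (g t) = F t) -> Phi h) -> has_table c Phi.
Proof.
move=> ginj; have [f fE] := extend_along F ginj.
have [c0 H] := has_table_eventually (\max_t g t).+1 f.
exists c0 => c Phi c0c PhiP; apply: (H _ _ c0c) => h hE; apply: PhiP => t.
by rewrite hE ?fE // ltnS (leq_bigmax t).
Qed.

(** A matrix with independent rows has a right inverse; arbitrary finite index types spare a
    numbering of the tuples that index certificates. *)
Lemma dual_family (F : fieldType) (I K : finType) (t : I -> K -> F) :
  (forall x : I -> F, (forall k, \sum_i x i * t i k = 0) -> forall i, x i = 0) ->
  exists B : K -> I -> F, forall i i', \sum_k t i k * B k i' = (i == i')%:R.
Proof.
move=> H; pose T : 'M[F]_(#|I|, #|K|) := \matrix_(i, k) t (enum_val i) (enum_val k).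
have /row_freeP[B TB] : row_free T.
  apply: inj_row_free => v vT; apply/rowP => i; rewrite mxE -[i]enum_valK.
  apply: (H (fun i => v 0 (enum_rank i))) => k.
  have := congr1 (fun M : 'rV_ _ => M 0 (enum_rank k)) vT; rewrite !mxE => E; rewrite -[RHS]E.
  rewrite [RHS](reindex enum_rank) /=; last by apply: onW_bij; exact: enum_rank_bij.
  by apply: eq_bigr => j _; rewrite mxE !enum_rankK.
exists (fun k i => B (enum_rank k) (enum_rank i)) => i i'.
have := congr1 (fun M : 'M_ _ => M (enum_rank i) (enum_rank i')) TB.
rewrite !mxE (inj_eq enum_rank_inj) => E; rewrite -[RHS]E.
rewrite [RHS](reindex enum_rank) /=; last by apply: onW_bij; exact: enum_rank_bij.
by apply: eq_bigr => k _; rewrite mxE !enum_rankK.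
Qed.

Lemma code_inj : injective CodeSeq.code.
Proof. exact: can_inj CodeSeq.codeK. Qed.

Section Certificates.
Variables (n m : nat) (d : nat -> nat) (phi : nat -> nat -> nat -> rat).

Definition phi_mx (j : 'I_m) : 'M[rat]_(n, d j) := \matrix_(i, l) phi j i l.
Let N := grid_den n m.

Lemma grid_den_gt0 : (0 < N)%N. Proof. exact: fact_gt0. Qed.

(** The equations for [B] expand each entry of [X] as a combination of the entries of the
    [A_j X phi_j], which all vanish. *)
Lemma member_cert_sound xi c : member_cert n m d phi xi c ->
  exists2 k, (0 < k)%N & cert phi_mx 0 1%:M (fun j => k * grid_num n m xi j)%N (k * N).
Proof.
case/has_belowP => k _ /has_tableP[A /has_tableP[B H]]; exists k.+1 => //.
pose q := (k.+1 * N)%N; pose p (j : 'I_m) := (k.+1 * grid_num n m xi j)%N.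
exists (fun j => \matrix_(r, a) A (CodeSeq.code [:: val j; val r; val a])).
move=> X _ XK; rewrite submx0; apply/eqP/matrixP => a' i'; rewrite mxE.
have {}XK (j : 'I_m) (r : 'I_(p j)) (l : 'I_(d j)) : \sum_(i < n) \sum_(a < q)
    X a i * (phi j i l * A (CodeSeq.code [:: val j; val r; val a])) = 0.
  have := XK j; rewrite mul0mx => /submx0null/matrixP/(_ r l); rewrite !mxE => E.
  rewrite -[RHS]E.
  apply: eq_bigr => i _; rewrite !mxE mulr_suml; apply: eq_bigr => a _.
  by rewrite mxE; ring.
have E (i : 'I_n) (a : 'I_q) : X a i * ((i == i') && (a == a'))%:R =
  \sum_(j < m) \sum_(r < p j) \sum_(l < d j)
    X a i * (phi j i l * A (CodeSeq.code [:: val j; val r; val a])) *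
    B (CodeSeq.code [:: val j; val r; val l; val i'; val a']).
  have /all_belowP/(_ _ (ltn_ord i)) := H.
  move=> /all_belowP/(_ _ (ltn_ord a)) /all_belowP/(_ _ (ltn_ord i')).
  move=> /all_belowP/(_ _ (ltn_ord a'))/eqP; rewrite /sum_below_rat => <-.
  rewrite mulr_sumr; apply: eq_bigr => j _; rewrite mulr_sumr; apply: eq_bigr => r _.
  by rewrite mulr_sumr; apply: eq_bigr => l _; rewrite !mulrA.
transitivity (\sum_(i < n) \sum_(a < q) X a i * ((i == i') && (a == a'))%:R).
  rewrite (bigD1 i') //= [X in _ + X]big1 ?addr0 => [|i /negPf ii']; last first.
    by apply: big1 => a _; rewrite ii' mulr0.
  rewrite (bigD1 a') //= big1 ?addr0 => [|a /negPf aa'].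
    by rewrite !eqxx mulr1.
  by rewrite aa' andbF mulr0.
under eq_bigr do under eq_bigr do rewrite E.
under eq_bigr do rewrite exchange_big /=.
rewrite exchange_big big1 //= => j _.
under eq_bigr do rewrite exchange_big /=.
rewrite exchange_big big1 //= => r _.
under eq_bigr do rewrite exchange_big /=.
rewrite exchange_big big1 //= => l _.
under eq_bigr do rewrite -mulr_suml.
by rewrite -mulr_suml XK mul0r.
Qed.

Lemma member_cert_complete xi k : (0 < k)%N ->
  cert phi_mx 0 1%:M (fun j => k * grid_num n m xi j)%N (k * N) ->
  exists c0, forall c, (c0 <= c)%N -> member_cert n m d phi xi c.
Proof.
case: k => // k _; set q := (_ * N)%N.
pose p (j : 'I_m) := (k.+1 * grid_num n m xi j)%N; move=> [A cA].
pose I : finType := ('I_n * 'I_q)%type.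
pose TA : finType := {j : 'I_m & ('I_(p j) * 'I_q)%type}.
pose K : finType := {j : 'I_m & ('I_(p j) * 'I_(d j))%type}.
pose t (x : I) (y : K) := phi (tag y) x.1 (tagged y).2 * A (tag y) (tagged y).1 x.2.
have [|B BE] := @dual_family rat I K t.
  move=> x H [i a]; pose X : 'M_(q, n) := \matrix_(a, i) x (i, a).
  suff : X = 0 by move/matrixP/(_ a i); rewrite !mxE.
  apply/eqP; rewrite -submx0; apply: cA; first exact: submx1.
  move=> j; suff -> : A j *m X *m phi_mx j = 0 by rewrite sub0mx.
  apply/matrixP => r l; rewrite [RHS]mxE.
  rewrite -[RHS](H (existT _ j (r, l))).
  transitivity (\sum_i \sum_a x (i, a) * t (i, a) (existT _ j (r, l))); last first.
    by rewrite pair_bigA; apply: eq_bigr => -[].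
  rewrite mxE; apply: eq_bigr => i' _; rewrite !mxE mulr_suml.
  by apply: eq_bigr => a' _; rewrite !mxE /t /=; ring.
pose gA (y : TA) := CodeSeq.code [:: val (tag y); val (tagged y).1; val (tagged y).2].
have gAinj : injective gA.
  move=> [j [r a]] [j' [r' a']] /code_inj[/val_inj ej er ea]; subst j'.
  by rewrite (val_inj er : r = r') (val_inj ea : a = a').
have [cA0 HA] := has_table_on (fun y : TA => A (tag y) (tagged y).1 (tagged y).2) gAinj.
pose gB (y : K * I) := CodeSeq.code
  [:: val (tag y.1); val (tagged y.1).1; val (tagged y.1).2; val y.2.1; val y.2.2].
have gBinj : injective gB.
  move=> [[j [r l]] [i a]] [[j' [r' l']] [i' a']] /code_inj[/val_inj ej er el ei ea].
  subst j'; rewrite (val_inj er : r = r') (val_inj el : l = l').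
  by rewrite (val_inj ei : i = i') (val_inj ea : a = a').
have [cB0 HB] := has_table_on (fun y : K * I => B y.1 y.2) gBinj.
exists (k + cA0 + cB0).+1 => c cc; apply/has_belowP; exists k; first by lia.
apply: HA => [|fA fAE]; first by lia.
apply: HB => [|fB fBE]; first by lia.
apply/all_belowP => i0 li; apply/all_belowP => a0 la.
apply/all_belowP => i0' li'; apply/all_belowP => a0' la'.
pose i := Ordinal li; pose a := Ordinal la; pose i' := Ordinal li'; pose a' := Ordinal la'.
have := BE (i, a) (i', a').
have -> : ((i, a) == (i', a') :> I) = (i0 == i0') && (a0 == a0') by [].
move=> <-; apply/eqP; rewrite /sum_below_rat.
under eq_bigr => j _ do rewrite (pair_bigA _
  (fun (r : 'I_(p j)) (l : 'I_(d j)) => phi j i0 l *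
     fA (CodeSeq.code [:: val j; val r; a0])
     * fB (CodeSeq.code [:: val j; val r; val l; i0'; a0']))) /=.
rewrite sig_big_dep /=; apply: eq_bigr => y _; rewrite /t /=.
by rewrite -(fAE (existT _ (tag y) ((tagged y).1, a))) -(fBE (y, (i', a'))).
Qed.
End Certificates.

(** * Membership of grid points *)

Section Grid.
Variables (n m : nat) (d : nat -> nat) (phi : nat -> nat -> nat -> rat).
Let N := grid_den n m.
Let phiM := phi_mx n (m := m) d phi.
Let sigma xi (j : 'I_m) := grid_num n m xi j.

Definition grid_point (F : realFieldType) xi : 'rV[F]_m :=
  \row_j ((sigma xi j)%:R / N%:R).

Lemma natr_grid_den_gt0 (F : realFieldType) : 0 < N%:R :> F.
Proof. by rewrite ltr0n grid_den_gt0. Qed.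

Lemma grid_num_le xi j : (sigma xi j <= N)%N.
Proof. by rewrite -ltnS; exact: digit_lt. Qed.

Lemma grid_point_box (F : realFieldType) xi j : 0 <= grid_point F xi 0 j <= 1.
Proof.
rewrite mxE divr_ge0 ?ler0n //= ler_pdivrMr ?natr_grid_den_gt0 // mul1r ler_nat.
exact: grid_num_le.
Qed.

(** The right-hand side does not mention [F]. This carries membership found by rational certificates
    over to the real polytope. *)
Lemma grid_point_in (F : realFieldType) xi :
  in_poly phiM 0 1%:M (grid_point F xi) <->
  forall W : 'M_n, (N * \rank W <= \sum_j sigma xi j * \rank (W *m phiM j))%N.
Proof.
have E (W : 'M_n) : (\rank W)%:R - (\rank (0 : 'M[rat]_n))%:R <= \sum_j grid_point F xi 0 j *
      ((\rank (W *m phiM j))%:R - (\rank ((0 : 'M[rat]_n) *m phiM j))%:R) :> F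
    <-> (N * \rank W <= \sum_j sigma xi j * \rank (W *m phiM j))%N.
  rewrite mxrank0 subr0 -(ler_nat F) natrM natr_sum mulrC -ler_pdivlMr ?natr_grid_den_gt0 //.
  rewrite mulr_suml -propeqE; congr (is_true (_ <= _)); apply: eq_bigr => j _.
  by rewrite mul0mx mxrank0 subr0 mxE natrM; ring.
split=> [[_ H] W|H]; first by apply/E; apply: H; rewrite ?sub0mx ?submx1.
split=> [j|W _ _]; last exact/E.
exact: grid_point_box.
Qed.

Lemma member_cert_in_poly F xi c : member_cert n m d phi xi c ->
  in_poly phiM 0 1%:M (grid_point F xi).
Proof.
case/member_cert_sound => k k0 /cert_soundness H; apply/grid_point_in => W.
have := H _ W; rewrite -mulnA; under eq_bigr do rewrite -mulnA.
by rewrite -big_distrr /= leq_pmul2l.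
Qed.

(** Completeness yields some number [q] of columns; [N] copies of that certificate have the shape
    [q * grid_num], [q * N] that the search expects. *)
Lemma member_cert_eventually xi : in_poly phiM 0 1%:M (grid_point rat xi) ->
  exists c0, forall c, (c0 <= c)%N -> member_cert n m d phi xi c.
Proof.
move=> /(certified_complete (sub0mx _ _))[q [p [q0 c ps]]].
apply: (member_cert_complete q0).
have -> : (fun j : 'I_m => q * grid_num n m xi j)%N = (fun j : 'I_m => N * p j)%N.
  apply/funext => j; apply/eqP; rewrite -(eqr_nat rat) !natrM ps mxE.
  by apply/eqP; field; rewrite gt_eqF ?natr_grid_den_gt0.
by rewrite mulnC; apply: cert_scale => //; exact: grid_den_gt0.
Qed.

Lemma mxrank_ge_right_inverse r k (U : 'M[rat]_(r, k)) (U' : 'M_(k, r)) :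
  U *m U' = 1%:M -> \rank U = r.
Proof. by move=> UU; apply/eqP; apply/row_freeP; exists U'. Qed.

Lemma nonmember_cert_not_in F xi c : nonmember_cert n m d phi xi c ->
  ~ in_poly phiM 0 1%:M (grid_point F xi).
Proof.
case/has_belowP => r _ /has_digitsP[rho /has_tableP[U /has_tableP[U' /has_tableP[C
  /has_tableP[G /and3P[H1 H2 H3]]]]]] /grid_point_in HW.
pose Um : 'M[rat]_(r, n) := \matrix_(a, i) U (CodeSeq.code [:: val a; val i]).
pose Um' : 'M[rat]_(n, r) := \matrix_(i, a) U' (CodeSeq.code [:: val i; val a]).
have rU : \rank Um = r.
  apply: (@mxrank_ge_right_inverse _ _ _ Um'); apply/matrixP => a a'; rewrite !mxE.
  have /all_belowP/(_ _ (ltn_ord a))/all_belowP/(_ _ (ltn_ord a'))/eqP := H1.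
  rewrite /sum_below_rat => E; rewrite -[RHS]E.
  by apply: eq_bigr => i _; rewrite !mxE.
have rUphi (j : 'I_m) : (\rank (Um *m phiM j) <= rho j)%N.
  pose Cm : 'M[rat]_(r, rho j) := \matrix_(a, t) C (CodeSeq.code [:: val j; val a; val t]).
  pose Gm : 'M[rat]_(rho j, d j) := \matrix_(t, l) G (CodeSeq.code [:: val j; val t; val l]).
  suff -> : Um *m phiM j = Cm *m Gm.
    by rewrite (leq_trans (mxrankM_maxr _ _)) ?rank_leq_row.
  apply/matrixP => a l; rewrite !mxE.
  have /all_belowP/(_ _ (ltn_ord j))/all_belowP/(_ _ (ltn_ord a)) := H2.
  move=> /all_belowP/(_ _ (ltn_ord l))/eqP; rewrite /sum_below_rat => E.
  by under eq_bigr do rewrite !mxE; under [RHS]eq_bigr do rewrite !mxE.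
(* Subspaces are quantified as square matrices, hence the square generator of the row space of
   [Um]. *)
have := HW <<Um>>%MS; rewrite genmxE rU leqNgt => /negP; apply.
apply: leq_ltn_trans H3; apply: leq_sum => j _; rewrite leq_mul2l.
by rewrite (eqmxMr (phiM j) (genmxE Um)) rUphi orbT.
Qed.

Lemma nonmember_cert_eventually xi : ~ in_poly phiM 0 1%:M (grid_point rat xi) ->
  exists c0, forall c, (c0 <= c)%N -> nonmember_cert n m d phi xi c.
Proof.
move=> nin; have [W HW] : exists W : 'M_n,
    ~~ (N * \rank W <= \sum_j sigma xi j * \rank (W *m phiM j))%N.
  by apply: contra_notP nin => /forallNP H; apply/grid_point_in => W; exact/negPn/negP.
pose r := \rank W; pose Um := row_base W; pose rho (j : 'I_m) := \rank (Um *m phiM j).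
have /row_freeP[Um' UU'] : row_free Um := row_base_free W.
pose Cm (j : 'I_m) : 'M_(r, rho j) := col_base (Um *m phiM j).
pose Gm (j : 'I_m) : 'M_(rho j, d j) := row_base (Um *m phiM j).
pose gU (x : 'I_r * 'I_n) := CodeSeq.code [:: val x.1; val x.2].
pose gU' (x : 'I_n * 'I_r) := CodeSeq.code [:: val x.1; val x.2].
pose TC : finType := {j : 'I_m & ('I_r * 'I_(rho j))%type}.
pose TG : finType := {j : 'I_m & ('I_(rho j) * 'I_(d j))%type}.
pose gC (x : TC) := CodeSeq.code [:: val (tag x); val (tagged x).1; val (tagged x).2].
pose gG (x : TG) := CodeSeq.code [:: val (tag x); val (tagged x).1; val (tagged x).2].
have gUinj : injective gU.
  by move=> [a b] [a' b'] /code_inj[e f]; rewrite (val_inj e : a = a') (val_inj f : b = b').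
have gU'inj : injective gU'.
  by move=> [a b] [a' b'] /code_inj[e f]; rewrite (val_inj e : a = a') (val_inj f : b = b').
have gCinj : injective gC.
  move=> [j [a b]] [j' [a' b']] /code_inj[/val_inj ej e f]; subst j'.
  by rewrite (val_inj e : a = a') (val_inj f : b = b').
have gGinj : injective gG.
  move=> [j [a b]] [j' [a' b']] /code_inj[/val_inj ej e f]; subst j'.
  by rewrite (val_inj e : a = a') (val_inj f : b = b').
have [cU HU] := has_table_on (fun x : 'I_r * 'I_n => Um x.1 x.2) gUinj.
have [cU' HU'] := has_table_on (fun x : 'I_n * 'I_r => Um' x.1 x.2) gU'inj.
have [cC HC] := has_table_on (fun x : TC => Cm (tag x) (tagged x).1 (tagged x).2) gCinj.
have [cG HG] := has_table_on (fun x : TG => Gm (tag x) (tagged x).1 (tagged x).2) gGinj.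
have [rh rhE] := extend_along rho (@ord_inj m).
have [cr Hr] := has_digits_eventually m rh.
exists (r + cU + cU' + cC + cG + cr).+1 => c cc; apply/has_belowP; exists r; first by lia.
apply: Hr => [|rn rnE]; first by lia.
have {rh rhE}rnE (j : 'I_m) : rn j = rho j by rewrite rnE ?rhE.
apply: HU => [|fU fUE]; first by lia.
have {}fUE a i : fU (CodeSeq.code [:: val a; val i]) = Um a i := fUE (a, i).
apply: HU' => [|fU' fUE']; first by lia.
have {}fUE' i a : fU' (CodeSeq.code [:: val i; val a]) = Um' i a := fUE' (i, a).
apply: HC => [|fC fCE]; first by lia.
have {}fCE j a t : fC (CodeSeq.code [:: val j; val a; val t]) = Cm j a t :=
  fCE (existT _ j (a, t)).
apply: HG => [|fG fGE]; first by lia.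
have {}fGE j t l : fG (CodeSeq.code [:: val j; val t; val l]) = Gm j t l :=
  fGE (existT _ j (t, l)).
apply/and3P; split.
- apply/all_belowP => a la; apply/all_belowP => a' la'; apply/eqP.
  have := congr1 (fun M : 'M_r => M (Ordinal la) (Ordinal la')) UU'.
  rewrite [LHS]mxE [RHS]mxE -[Ordinal la == _]/(a == a') => E; rewrite -[RHS]E.
  apply: eq_bigr => i _; by rewrite -fUE -fUE'.
- apply/all_belowP => j lj; apply/all_belowP => a la; apply/all_belowP => l ll; apply/eqP.
  rewrite (rnE (Ordinal lj) : rn j = rho (Ordinal lj)).
  have := congr1 (fun M : 'M_(_, _) => M (Ordinal la) (Ordinal ll))
    (mulmx_base (Um *m phiM (Ordinal lj))).
  rewrite [LHS]mxE [RHS]mxE => E; rewrite /sum_below_rat.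
  transitivity (\sum_k Um (Ordinal la) k * phiM (Ordinal lj) k (Ordinal ll)).
    by apply: eq_bigr => i _; rewrite [phiM _ _ _]mxE -fUE.
  rewrite -E; apply: eq_bigr => t _.
  by rewrite (fCE (Ordinal lj) (Ordinal la)) (fGE (Ordinal lj) _ (Ordinal ll)).
move: HW; rewrite -ltnNge; apply: leq_trans; rewrite ltnS /sum_below.
apply: leq_sum => j _; rewrite rnE leq_mul2l /rho.
by rewrite (eqmxMr (phiM j) (eq_row_base W)) leqnn orbT.
Qed.

(** Each grid point is settled for all large bounds, so the maximum over the finite grid settles all
    of them at once. *)
Lemma search_check_eventually : exists c, search_check n m d phi c.
Proof.
have H xi : exists c0, forall c, (c0 <= c)%N ->
    member_cert n m d phi xi c || nonmember_cert n m d phi xi c.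
  have [/member_cert_eventually|/nonmember_cert_eventually] :=
    pselect (in_poly phiM 0 1%:M (grid_point rat xi)).
    by case=> c0 Hc; exists c0 => c /Hc ->.
  by case=> c0 Hc; exists c0 => c /Hc ->; rewrite orbT.
have [f fP] := choice H; exists (\max_(xi < grid_size n m) f xi)%N.
apply/all_belowP => xi lxi; apply: fP.
exact: (leq_bigmax (F := fun xi : 'I_ _ => f xi) (Ordinal lxi)).
Qed.

(** After a successful check, the lack of a membership certificate within the bound [c] entails a
    certificate of nonmembership: the bounded test decides. *)
Lemma member_certP F c xi : search_check n m d phi c -> (xi < grid_size n m)%N ->
  member_cert n m d phi xi c <-> in_poly phiM 0 1%:M (grid_point F xi).
Proof.
move=> /all_belowP Hc /Hc /orP Hxi; split; first exact: member_cert_in_poly.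
by case: Hxi => // /nonmember_cert_not_in H /H.
Qed.
End Grid.

(** * Inequalities and extreme points *)

(** Ratio test again: [e] is the least [b i / a i] over the positive [a i]. It prolongs a segment
    beyond an end point without leaving the polytope. *)
Lemma small_step (F : realFieldType) (I : finType) (a b : I -> F) :
  (forall i, 0 <= b i) -> (forall i, b i = 0 -> a i <= 0) ->
  exists2 e, 0 < e & forall i, e * a i <= b i.
Proof.
move=> b0 ab; have [i0|/forallNP none] := pselect (exists i, 0 < a i); last first.
  exists 1 => // i; rewrite mul1r; apply: le_trans (b0 i).
  by rewrite leNgt; apply/negP; exact: none.
have [i0' ai0] := i0.
case: (arg_minP (P := fun i => 0 < a i) (fun i => b i / a i) ai0) => j aj jmin.
exists (b j / a j).
  rewrite divr_gt0 // lt_neqAle b0 andbT; apply: contraTneq aj => bj.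
  by rewrite -leNgt ab.
move=> i; have [ai|ai] := ltrP 0 (a i).
  by rewrite -ler_pdivlMr //; exact: jmin.
by apply: le_trans (b0 i); rewrite mulr_ge0_le0 // divr_ge0 // ltW.
Qed.

Lemma comb_le (F : realFieldType) (t a b r : F) : 0 < t < 1 -> a <= r -> b <= r ->
  t * a + (1 - t) * b <= r.
Proof. by move=> /andP[? ?] *; nra. Qed.

Lemma comb_lt (F : realFieldType) (t a b r : F) : 0 < t < 1 -> a < r -> b <= r ->
  t * a + (1 - t) * b < r.
Proof. by move=> /andP[? ?] *; nra. Qed.

Lemma between_extension (F : realFieldType) m (e : F) (s y : 'rV[F]_m) : 0 < 1 + e ->
  s = (1 + e)^-1 *: (s + e *: (s - y)) + (1 - (1 + e)^-1) *: y.
Proof.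
by move=> e1; apply/rowP => j; rewrite !mxE; field; rewrite gt_eqF.
Qed.

Section Output.
Variables (n m : nat) (d : nat -> nat) (phi : nat -> nat -> nat -> rat) (c : nat).
Hypothesis Hc : search_check n m d phi c.
Variable F : realFieldType.
Implicit Types s : 'rV[F]_m.
Let N := grid_den n m.
Let phiM := phi_mx n (m := m) d phi.
Let P s := in_poly phiM 0 1%:M s.

Lemma in_poly_convex : convex_pred P.
Proof.
move=> x y t /sol_in_poly Px /sol_in_poly Py t01; apply/sol_in_poly => i.
by rewrite dotD !dotZ comb_le.
Qed.

Lemma grid_point_digits (sg : 'I_m -> nat) : (forall j, (sg j <= N)%N) ->
  exists2 xi, (xi < grid_size n m)%N & grid_point n m F xi = \row_j ((sg j)%:R / N%:R).
Proof.
move=> sgN; have [f fE] := extend_along sg (@ord_inj m).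
pose g j := if (j < m)%N then f j else 0%N.
have gN j : (j < m)%N -> (g j < N.+1)%N.
  by move=> jm; rewrite /g jm ltnS (fE (Ordinal jm)).
have [xi lxi xiE] := digit_exists gN; exists xi => //.
by apply/rowP => j; rewrite !mxE /grid_num xiE // /g ltn_ord fE.
Qed.

Lemma grid_point_inj xi up : (xi < grid_size n m)%N -> (up < grid_size n m)%N ->
  grid_point n m F xi = grid_point n m F up :> 'rV_m -> xi = up.
Proof.
move=> lxi lup E; apply: (digit_inj lxi lup) => j jm.
move/rowP/(_ (Ordinal jm)): E; rewrite !mxE => /(mulIf _)/eqP; rewrite eqr_nat => H.
by apply/eqP/H; rewrite invr_eq0 pnatr_eq0 -lt0n grid_den_gt0.
Qed.

Lemma vertex_grid s : P s ->
  vertex (fun i j => (lhs phiM 0 1%:M i j)%:~R) (fun i => (rhs phiM 0 1%:M i)%:~R) s ->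
  exists2 xi, (xi < grid_size n m)%N & s = grid_point n m F xi.
Proof.
move=> [box _] vs; have [D /andP[D0 DM] sD] := vertex_coord (norm_lhs phiM 0 1%:M) vs.
have /dvdnP[e Ne] : (D %| N)%N by rewrite dvdn_fact // D0.
have N0 : N%:R != 0 :> F by rewrite pnatr_eq0 -lt0n grid_den_gt0.
have D0' : D%:R != 0 :> F by rewrite pnatr_eq0 -lt0n.
have e0 : e%:R != 0 :> F by move: N0; rewrite Ne natrM mulf_eq0 negb_or => /andP[].
have /fin_all_exists[sg sgE] : forall j, exists z : nat, s 0 j = z%:R / N%:R.
  move=> j; have [z zE] := sD j; have /andP[s0 _] := box j.
  have z0 : 0 <= z.
    by rewrite -(ler0z F); move: s0; rewrite zE pmulr_lge0 // invr_gt0 ltr0n.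
  exists (`|z| * e)%N; rewrite zE Ne !natrM natr_absz ger0_norm //.
  by field; rewrite D0'.
have sgN j : (sg j <= N)%N.
  have /andP[_] := box j; rewrite sgE ler_pdivrMr ?mul1r ?ler_nat //.
  by rewrite ltr0n grid_den_gt0.
have [xi lxi xiE] := grid_point_digits sgN; exists xi => //.
by rewrite xiE; apply/rowP => j; rewrite mxE sgE.
Qed.

(** The convex hull as an induction principle, which needs no explicit convex combinations. *)
Lemma grid_hull (Q : 'rV[F]_m -> Prop) : convex_pred Q ->
  (forall xi, (xi < grid_size n m)%N -> P (grid_point n m F xi) -> Q (grid_point n m F xi)) ->
  forall s, P s -> Q s.
Proof.
move=> cQ gQ s /sol_in_poly; move: s; apply: polytope_ind cQ _; first exact: bounded_poly.
move=> s /sol_in_poly Ps /(vertex_grid Ps)[xi lxi E].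
by rewrite E; apply: gQ; rewrite // -E.
Qed.

Definition ineq_coef la j : int :=
  (digit (ineq_base n) la j)%:Z - (coef_bound n)%:Z.

Definition ineq_dot la s := dot (fun j : 'I_m => (ineq_coef la j)%:~R) s.
Definition ineq_rhs la : F := (ineq_coef la m)%:~R.

Lemma slackE la xi :
  ratr (slack n m la xi) = N%:R * (ineq_rhs la - ineq_dot la (grid_point n m F xi)).
Proof.
have N0 : N%:R != 0 :> F by rewrite pnatr_eq0 -lt0n grid_den_gt0.
have E j : ratr (ineq_lhs n la j) = (ineq_coef la j)%:~R :> F.
  by rewrite /ineq_lhs /ineq_coef !rmorphB /= !ratr_nat.
rewrite /slack rmorphB rmorphM /= E ratr_nat mulrBr mulrC; congr (_ - _).
rewrite /sum_below_rat rmorph_sum /ineq_dot /dot mulr_sumr; apply: eq_bigr => j _.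
rewrite rmorphM /= E ratr_nat mxE.
by rewrite [RHS]mulrCA [N%:R * _]mulrC divfK.
Qed.

Lemma slack_eq0 la xi :
  (slack n m la xi == 0) = (ineq_dot la (grid_point n m F xi) == ineq_rhs la).
Proof.
rewrite -(fmorph_eq0 (@ratr F)) /= slackE mulf_eq0 pnatr_eq0.
by rewrite eqn0Ngt grid_den_gt0 /= subr_eq0 eq_sym.
Qed.

Lemma valid_ineqP la :
  valid_ineq n m d phi c la <-> forall s, P s -> ineq_dot la s <= ineq_rhs la.
Proof.
split=> [/all_belowP H|H].
  apply: grid_hull.
    by move=> x y t Hx Hy t01; rewrite /ineq_dot dotD !dotZ comb_le.
  move=> xi lxi /(member_certP F Hc lxi) Mxi; have /implyP/(_ Mxi) := H _ lxi.
  rewrite -(ler0q F) slackE pmulr_rge0 ?subr_ge0 //.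
  by rewrite ltr0n grid_den_gt0.
apply/all_belowP => xi lxi; apply/implyP => /(member_certP F Hc lxi)/H.
rewrite -(ler0q F) slackE pmulr_rge0 ?subr_ge0 //.
by rewrite ltr0n grid_den_gt0.
Qed.

Lemma ineq_index (a : 'I_m -> int) (b : int) :
  (forall j, `|a j| <= n.+1%:Z) -> `|b| <= n.+1%:Z ->
  exists la, [/\ (la < ineq_count n m)%N, forall j : 'I_m, ineq_coef la j = a j
    & ineq_coef la m = b].
Proof.
move=> an bn; pose z (x : int) := absz (x + n.+1%:Z).
have zE (x : int) : `|x| <= n.+1%:Z -> (z x < ineq_base n)%N /\
    (z x)%:Z - (coef_bound n)%:Z = x.
  by rewrite /z /ineq_base /coef_bound => ?; split; lia.
have [f fE] := extend_along a (@ord_inj m).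
pose g j := if (j < m)%N then z (f j) else z b.
have gb j : (j < m.+1)%N -> (g j < ineq_base n)%N.
  move=> _; rewrite /g; case: ifP => [jm|_]; last by have [] := zE _ bn.
  by rewrite (fE (Ordinal jm)); have [] := zE _ (an (Ordinal jm)).
have [la lla laE] := digit_exists gb; exists la; split=> // [j|].
  rewrite /ineq_coef laE ?ltnS 1?ltnW // /g ltn_ord fE.
  by have [] := zE _ (an j).
by rewrite /ineq_coef laE // /g ltnn; have [] := zE _ bn.
Qed.

(** The defining inequalities have small coefficients, hence are among the tested ones; any further
    inequality in the list holds on the polytope by its validity. *)
Lemma in_polyP s : P s <->
  forall la, (la < ineq_count n m)%N -> valid_ineq n m d phi c la ->
    ineq_dot la s <= ineq_rhs la.
Proof.
split=> [Ps la _ /valid_ineqP|H]; first exact.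
apply/sol_in_poly => i.
have [la [lla laE laE']] := ineq_index (norm_lhs phiM 0 1%:M i) (norm_rhs phiM 0 1%:M i).
have dE s' : ineq_dot la s' = dot (fun j => (lhs phiM 0 1%:M i j)%:~R) s'.
  by apply: eq_bigr => j _; rewrite laE.
have rE : ineq_rhs la = (rhs phiM 0 1%:M i)%:~R by rewrite /ineq_rhs laE'.
rewrite -dE -rE; apply: H => //; apply/valid_ineqP => s' /sol_in_poly Ps'.
by rewrite dE rE.
Qed.

Lemma extreme_point_grid s : extreme_point P s <->
  exists2 xi, (xi < grid_size n m)%N && extreme_grid n m d phi c xi
    & s = grid_point n m F xi.
Proof.
split=> [[Ps ext]|[xi /andP[lxi /andP[Mxi /all_belowP ext]] ->]].
  have [xi lxi sE] : exists2 xi, (xi < grid_size n m)%N & s = grid_point n m F xi.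
    apply: contrapT => nxi.
    (* Removing an extreme point leaves a convex set. If [s] were not a grid point, this set would
       contain all grid points of the polytope and so, by [grid_hull], the point [s] itself. *)
    have [] : P s /\ s <> s; last by [].
    apply: (grid_hull (Q := fun y => P y /\ y <> s)) Ps => [x y t [Px xs] [Py ys] t01|].
      split=> [|E]; first exact: in_poly_convex.
      have xy := ext x y t Px Py t01 (esym E).
      by apply: xs; rewrite -E xy -scalerDl addrC subrK scale1r.
    by move=> xi lxi Pxi; split=> // E; apply: nxi; exists xi.
  exists xi => //; rewrite lxi /=; apply/andP; split.
    by apply/(member_certP F Hc lxi); rewrite -/phiM -sE.
  apply/all_belowP => up lup; apply/implyP => /andP[Mup upxi].
  apply: contraT => /has_belowP none.
  have Pup : P (grid_point n m F up) by apply/(member_certP F Hc lup).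
  set y := grid_point n m F up in Pup.
  have H la : (la < ineq_count n m)%N -> valid_ineq n m d phi c la ->
      ineq_dot la s = ineq_rhs la -> ineq_dot la y = ineq_rhs la.
    move=> lla vla tla; apply/eqP; apply: contraT => ntla.
    case: none; exists la => //; rewrite vla !slack_eq0 -sE tla eqxx /=.
    exact: ntla.
  (* Every valid inequality tight at [s] is tight at [y], so the segment from [y] to [s] can be
     prolonged beyond [s], against extremality. Inequalities that are not valid are masked by 0. *)
  pose a (i : 'I_(ineq_count n m)) :=
    if valid_ineq n m d phi c i then ineq_dot i s - ineq_dot i y else 0.
  pose b (i : 'I_(ineq_count n m)) :=
    if valid_ineq n m d phi c i then ineq_rhs i - ineq_dot i s else 0.
  have [i|i|e e0 eab] := @small_step F _ a b.
  - by rewrite /b; case: ifP => // /valid_ineqP/(_ _ Ps); rewrite subr_ge0.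
  - rewrite /a /b; case: ifP => // vi /eqP; rewrite subr_eq0 => /eqP ti.
    by rewrite -ti (H i) // subrr.
  have Pz : P (s + e *: (s - y)).
    apply/in_polyP => la lla vla; have := eab (Ordinal lla); rewrite /a /b /= vla.
    by rewrite /ineq_dot !(dotD, dotZ, dotN) lerBrDl.
  have e1 : 0 < 1 + e by rewrite addr_gt0.
  have := ext _ y (1 + e)^-1 Pz Pup; rewrite invr_gt0 e1 invf_lt1 // ltrDl e0.
  move=> /(_ isT) zy.
  have zyE : s + e *: (s - y) = y.
    by apply: zy; exact: between_extension.
  have sy : s = y.
    apply/eqP; rewrite -subr_eq0; have : (1 + e) *: (s - y) == 0.
      by rewrite scalerDl scale1r addrAC zyE subrr.
    by rewrite scaler_eq0 gt_eqF.
  by move: upxi; rewrite -(grid_point_inj lxi lup _) ?eqxx // -sE.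
set x := grid_point n m F xi; have Px : P x by exact/(member_certP F Hc lxi).
split=> // y z t Py Pz t01 E.
(* The test provides this dichotomy at grid points, and it is stable under convex combinations. A
   combination equal to [x] cannot involve a point strictly inside an inequality tight at [x]. *)
suff K w : P w -> w = x \/ exists la, [/\ valid_ineq n m d phi c la,
    ineq_dot la x = ineq_rhs la & ineq_dot la w < ineq_rhs la].
  have KE y' z' t' : P y' -> P z' -> 0 < t' < 1 ->
      x = t' *: y' + (1 - t') *: z' -> y' = x.
    move=> Py' Pz' t01' E'; case: (K y' Py') => // -[la [vla tla sla]].
    have /valid_ineqP/(_ _ Pz') le := vla.
    have : ineq_dot la x < ineq_rhs la; last by rewrite tla ltxx.
    by rewrite E' /ineq_dot dotD !dotZ comb_lt.
  rewrite (KE y z t) // (KE z y (1 - t)) //; first by have /andP[? ?] := t01; lra.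
  by rewrite subKr addrC.
move: w; suff K w : P w -> P w /\ (w = x \/ exists la, [/\ valid_ineq n m d phi c la,
    ineq_dot la x = ineq_rhs la & ineq_dot la w < ineq_rhs la]) by move=> w /K[].
move: w; apply: grid_hull => [w w' t' [Pw Kw] [Pw' Kw'] t01'|up lup Pup].
  split; first exact: in_poly_convex.
  case: Kw => [->|[la [vla tla sla]]].
    case: Kw' => [->|[la [vla tla sla]]].
      by left; rewrite -scalerDl addrC subrK scale1r.
    (* The first point is [x], so strictness comes from the second; the summands are swapped for
       [comb_lt]. *)
    right; exists la; split=> //; rewrite /ineq_dot dotD !dotZ -[t' in t' * _](subKr 1).
    rewrite addrC comb_lt //; first by have /andP[? ?] := t01'; lra.
    by rewrite -/(ineq_dot la x) tla.
  right; exists la; split=> //; rewrite /ineq_dot dotD !dotZ comb_lt //.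
  by have /valid_ineqP/(_ _ Pw') := vla.
split=> //; have [E'|upxi] := eqVneq up xi; first by left; rewrite E'.
have /implyP := ext _ lup; rewrite upxi andbT => /(_ _)/has_belowP[].
  exact/(member_certP F Hc lup).
move=> la lla /and3P[vla]; rewrite !slack_eq0 => /eqP tla ntla.
right; exists la; split=> //; rewrite lt_neqAle ntla.
by have /valid_ineqP := vla; apply.
Qed.
End Output.

Local Open Scope classical_set_scope.

(** * Input and output *)

Section SpanRows.
Import passmx.
Variables (F : fieldType) (vT : vectType F) (e : (\dim {:vT}).-tuple vT).
Hypothesis e_basis : basis_of {:vT} e.

(** Leads back from coordinates to abstract subspaces; with [passmx.msof] it matches subspaces with
    row spaces of matrices. *)
Definition span_rows k (M : 'M[F]_(k, \dim {:vT})) : {vspace vT} :=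
  <<[seq vecof e (row i M) | i <- enum 'I_k]>>%VS.

Lemma span_rows_sub k l (M : 'M_(k, _)) (M' : 'M_(l, _)) :
  (M <= M')%MS -> (span_rows M <= span_rows M')%VS.
Proof.
case/submxP => D ->; apply/span_subvP => _ /mapP[i _ ->].
rewrite row_mul mulmx_sum_row linear_sum rpred_sum // => j _.
by rewrite linearZ rpredZ //; apply/memv_span/mapP; exists j; rewrite ?mem_enum.
Qed.

Lemma dim_span_rows k (M : 'M_(k, _)) : \dim (span_rows M) = \rank M.
Proof.
have -> : span_rows M = span_rows (row_base M).
  by apply: subv_anti; rewrite !span_rows_sub ?eq_row_base.
pose b := [tuple vecof e (row i (row_base M)) | i < \rank M].
suff /eqP fb : free b by rewrite -[RHS](size_tuple b) -fb.
apply/freeP => a.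
have -> : \sum_(i < \rank M) a i *: b`_i = vecof e ((\row_i a i) *m row_base M).
  rewrite mulmx_sum_row linear_sum; apply: eq_bigr => i _.
  by rewrite linearZ mxE -tnth_nth tnth_mktuple.
move/eqP; rewrite vecof_eq0 // mulmx_free_eq0 ?row_base_free // => /eqP/rowP a0 i.
by have := a0 i; rewrite !mxE.
Qed.
Lemma span_rows_msof (W : {vspace vT}) : span_rows (msof e W) = W.
Proof.
apply: subv_anti; apply/andP; split.
  by apply/span_subvP => _ /mapP[i _ ->]; rewrite mem_vecof // row_sub.
apply/subvP => w; rewrite -(rVofK e_basis w) mem_vecof // => /span_rows_sub/subvP; apply.
by apply/memv_span/mapP; exists 0; rewrite ?mem_enum // row_id.
Qed.
End SpanRows.

Lemma dim_image_span_rows (F : fieldType) (uT vT : vectType F)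
    (e : (\dim {:uT}).-tuple uT) (f : (\dim {:vT}).-tuple vT) (h : 'Hom(uT, vT)) k
    (M : 'M_(k, _)) :
  basis_of {:uT} e -> basis_of {:vT} f ->
  \dim (h @: span_rows e M) = \rank (M *m passmx.mxof e f h).
Proof.
move=> be bf; rewrite -(dim_span_rows bf) limg_span; congr (\dim (span _)).
rewrite -map_comp; apply: eq_map => i /=.
by rewrite row_mul -passmx.hom_vecof.
Qed.

(** The column number decoded from the input equals the dimension only propositionally, so the two
    matrices have different types; their ranks can still be compared. *)
Lemma mxrank_cols (F : fieldType) n d d' (W : 'M[F]_n) (f : nat -> nat -> F)
    (G : 'M[F]_(n, d')) : d = d' -> (forall i l, f (val i) (val l) = G i l) ->
  \rank (W *m (\matrix_(i, l) f (val i) (val l) : 'M_(n, d))) = \rank (W *m G).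
Proof.
by move=> -> fG; congr (\rank (_ *m _)); apply/matrixP => i l; rewrite mxE fG.
Qed.

Lemma hbl_polytopeE (R : realType) (D : hbl_datum rat)
    (X : (\dim {:hbl_V D}).-tuple (hbl_V D))
    (Y : forall j, (\dim {:hbl_Vj D j}).-tuple (hbl_Vj D j))
    (d : nat -> nat) (phi : nat -> nat -> nat -> rat) :
  basis_of {:hbl_V D} X -> (forall j, basis_of {:hbl_Vj D j} (Y j)) ->
  (forall j : 'I_(hbl_m D), d j = \dim {:hbl_Vj D j}) ->
  (forall j i l, phi (val j) (val i) (val l) = passmx.mxof X (Y j) (hbl_phi D j) i l) ->
  hbl_polytope R D = [set s | in_poly (phi_mx (\dim {:hbl_V D}) d phi) 0 1%:M s].
Proof.
move=> bX bY dE phiE; set n := \dim {:hbl_V D}.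
have rE (W : 'M[rat]_n) (j : 'I_(hbl_m D)) :
    \rank (W *m phi_mx n d phi j) = \rank (W *m passmx.mxof X (Y j) (hbl_phi D j)).
  by apply: (mxrank_cols W (f := phi j)) (dE j) _ => i l; exact: phiE.
have E s (W : 'M[rat]_n) :
    ((\dim (span_rows X W))%:R <= \sum_(j < hbl_m D) s 0 j *
        (\dim (hbl_phi D j @: span_rows X W)%VS)%:R :> R) =
    ((\rank W)%:R - (\rank (0 : 'M[rat]_n))%:R <= \sum_j s 0 j *
      ((\rank (W *m phi_mx n d phi j))%:R
        - (\rank ((0 : 'M[rat]_n) *m phi_mx n d phi j))%:R)).
  rewrite mxrank0 subr0 dim_span_rows //; congr (_ <= _); apply: eq_bigr => j _.
  by rewrite mul0mx mxrank0 subr0 rE (dim_image_span_rows _ _ bX (bY j)).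
apply/seteqP; split=> s [box H]; split=> // W.
  by move=> _ _; rewrite -E; exact: H.
by have := H (passmx.msof X W) (sub0mx _ _) (submx1 _); rewrite -E span_rows_msof.
Qed.

Lemma nthc_pickle (T : countType) x0 (s : seq T) i : (i < size s)%N ->
  nthc (pickle s) i = pickle (nth x0 s i).
Proof. by move=> lis; rewrite -[pickle s]/(CodeSeq.code _) nthc_code (nth_map x0). Qed.

Lemma nthc_pickle1 (T U : countType) (p : T * U) : nthc (pickle p) 0 = pickle p.1.
Proof. by rewrite -[pickle p]/(CodeSeq.code [:: pickle p.1; pickle p.2]) nthc_code. Qed.

Lemma nthc_pickle2 (T U : countType) (p : T * U) : nthc (pickle p) 1 = pickle p.2.
Proof. by rewrite -[pickle p]/(CodeSeq.code [:: pickle p.1; pickle p.2]) nthc_code. Qed.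

Section Input.
Variables (D : hbl_datum rat) (X : (\dim {:hbl_V D}).-tuple (hbl_V D)).
Variable Y : forall j, (\dim {:hbl_Vj D j}).-tuple (hbl_Vj D j).
Let x := pickle (hbl_presentation X Y).
Let maps := (hbl_presentation X Y).2.

Lemma in_dimE : in_dim x = \dim {:hbl_V D}.
Proof. by rewrite /in_dim /x nthc_pickle1. Qed.

Lemma in_mE : in_m x = hbl_m D.
Proof.
rewrite /in_m /x nthc_pickle2 -[pickle _]/(CodeSeq.code (map pickle maps)) sizec_code.
by rewrite size_map /maps /= size_map size_enum_ord.
Qed.

Lemma nthc_maps (j : 'I_(hbl_m D)) : nthc (nthc x 1) j =
  pickle (\dim {:hbl_Vj D j}, mx_rows (passmx.mxof X (Y j) (hbl_phi D j))).
Proof.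
rewrite /x nthc_pickle2 (nthc_pickle (0%N, [::])) /=; last by rewrite size_map size_enum_ord.
by rewrite (nth_map j) ?size_enum_ord // nth_ord_enum.
Qed.

Lemma in_dimjE (j : 'I_(hbl_m D)) : in_dimj x j = \dim {:hbl_Vj D j}.
Proof. by rewrite /in_dimj nthc_maps nthc_pickle1. Qed.

Lemma in_phiE (j : 'I_(hbl_m D)) i l :
  in_phi x (val j) (val i) (val l) = passmx.mxof X (Y j) (hbl_phi D j) i l.
Proof.
rewrite /in_phi nthc_maps nthc_pickle2 /= (nthc_pickle [::]); last first.
  by rewrite size_map size_enum_ord.
rewrite (nth_map i) ?size_enum_ord // nth_ord_enum (nthc_pickle 0); last first.
  by rewrite size_map size_enum_ord.
by rewrite (nth_map l) ?size_enum_ord // nth_ord_enum ratc_pickle.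
Qed.
End Input.

Lemma pickle_mktuple (T : countType) m (f : 'I_m -> T) (F : nat -> nat) :
  (forall i : 'I_m, pickle (f i) = F i) -> pickle (mktuple f) = codef m F.
Proof.
move=> fF; rewrite -[pickle _]/(CodeSeq.code (map pickle (mktuple f))); congr CodeSeq.code.
by rewrite /= -map_comp (eq_map fF) -val_enum_ord -map_comp.
Qed.

Lemma pickle_filter (T : countType) k (P : pred nat) (f : nat -> T) (F : nat -> nat) :
  (forall i, pickle (f i) = F i) ->
  pickle [seq f i | i <- rev (iota 0 k) & P i] = codef_filter k P F.
Proof.
move=> fF; rewrite -[pickle _]/(CodeSeq.code (map pickle _)); congr CodeSeq.code.
by rewrite -map_comp (eq_map fF).
Qed.

Section OutputValue.
Variables (n m : nat) (d : nat -> nat) (phi : nat -> nat -> nat -> rat) (c : nat).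

Definition ineq_value la : m.-tuple int * int :=
  (mktuple (fun j : 'I_m => ineq_coef n la j), ineq_coef n la m).

Definition point_value xi : m.-tuple rat :=
  mktuple (fun j : 'I_m => (grid_num n m xi j)%:R / (grid_den n m)%:R).

Definition output_value : hbl_output m :=
  ([seq ineq_value la | la <- rev (iota 0 (ineq_count n m)) & valid_ineq n m d phi c la],
   [seq point_value xi | xi <- rev (iota 0 (grid_size n m)) & extreme_grid n m d phi c xi]).

Lemma pickle_output : pickle output_value = output_code n m d phi c.
Proof.
rewrite -[pickle _]/(CodeSeq.code [:: pickle output_value.1; pickle output_value.2]).
congr (CodeSeq.code [:: _; _]); apply: pickle_filter => i.
  rewrite -[pickle _]/(CodeSeq.code [:: pickle (ineq_value i).1; pickle (ineq_value i).2]).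
  congr (CodeSeq.code [:: _; _]); last exact: pickle_diff.
  by apply: pickle_mktuple => j; exact: pickle_diff.
by apply: pickle_mktuple => j; apply: pickle_frac; exact: grid_den_gt0.
Qed.

Lemma mem_output_value1 ab : ab \in output_value.1 <-> exists la,
  [/\ (la < ineq_count n m)%N, valid_ineq n m d phi c la & ab = ineq_value la].
Proof.
split=> [/mapP[la] | [la [lla vla ->]]].
  by rewrite mem_filter mem_rev mem_iota => /andP[vla /andP[_ lla]] ->; exists la.
by apply/mapP; exists la; rewrite // mem_filter vla mem_rev mem_iota.
Qed.

Lemma mem_output_value2 q : q \in output_value.2 <-> exists xi,
  [/\ (xi < grid_size n m)%N, extreme_grid n m d phi c xi & q = point_value xi].
Proof.
split=> [/mapP[xi] | [xi [lxi exi ->]]].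
  by rewrite mem_filter mem_rev mem_iota => /andP[exi /andP[_ lxi]] ->; exists xi.
by apply/mapP; exists xi; rewrite // mem_filter exi mem_rev mem_iota.
Qed.

Lemma rat_point_value (R : realType) xi :
  rat_point R (point_value xi) = grid_point n m R xi.
Proof. by apply/rowP => j; rewrite !mxE tnth_mktuple fmorph_div /= !ratr_nat. Qed.

Hypothesis Hc : search_check n m d phi c.

Lemma ineqs_solutions_output (R : realType) :
  ineqs_solutions R output_value.1 = [set s | in_poly (phi_mx n d phi) 0 1%:M s].
Proof.
have E la (s : 'rV[R]_m) :
    \sum_(j < m) (tnth (ineq_value la).1 j)%:~R * s 0 j = ineq_dot n la s.
  by apply: eq_bigr => j _; rewrite tnth_mktuple.
apply/seteqP; split=> s H.
  apply/(in_polyP Hc) => la lla vla; rewrite -E; apply: H.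
  by apply/mem_output_value1; exists la.
by move=> ab /mem_output_value1[la [lla vla ->]]; rewrite E; have /(in_polyP Hc) := H; apply.
Qed.

Lemma extreme_point_output (R : realType) s :
  extreme_point [set s | in_poly (phi_mx n d phi) 0 1%:M s] s <->
  exists2 q, q \in output_value.2 & s = rat_point R q.
Proof.
rewrite (extreme_point_grid Hc); split=> [[xi /andP[lxi exi] ->]|[q]].
  exists (point_value xi); last by rewrite rat_point_value.
  by apply/mem_output_value2; exists xi.
move=> /mem_output_value2[xi [lxi exi ->]] ->; exists xi; first by rewrite lxi.
exact: rat_point_value.
Qed.
End OutputValue.

Theorem theorem5p1 :
  exists alg : recfun,
  forall (D : hbl_datum rat)
         (X : (\dim {:hbl_V D}).-tuple (hbl_V D))
         (Y : forall j, (\dim {:hbl_Vj D j}).-tuple (hbl_Vj D j)),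
    basis_of {:hbl_V D} X ->
    (forall j, basis_of {:hbl_Vj D j} (Y j)) ->
  exists out : hbl_output (hbl_m D),
    computes alg (hbl_presentation X Y) out /\
    forall R : realType,
      hbl_polytope R D = ineqs_solutions R out.1 /\
      (forall s : 'rV[R]_(hbl_m D),
         extreme_point (hbl_polytope R D) s <->
         exists2 q, q \in out.2 & s = rat_point R q).
Proof.
have [alg algP] := recursive_search; exists alg => D X Y bX bY.
set x := pickle (hbl_presentation X Y).
(* The least successful bound is the one that minimization returns. *)
have [c Hc cmin] := ex_minnP (search_check_eventually (in_dim x) (in_m x)
  (in_dimj x) (in_phi x)).
have := algP x c; rewrite /search_code => /(_ (conj Hc _)) algx.
have {}algx : receval alg [:: x]
    (output_code (in_dim x) (in_m x) (in_dimj x) (in_phi x) c).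
  by apply: algx => c' ltc; apply: contraL ltc => /cmin; rewrite -leqNgt.
rewrite /x in_dimE in_mE -/x in Hc algx.
exists (output_value (\dim {:hbl_V D}) (hbl_m D) (in_dimj x) (in_phi x) c); split.
  by rewrite /computes pickle_output.
move=> R; rewrite (hbl_polytopeE R (d := in_dimj x) (phi := in_phi x) bX bY).
- split; first by rewrite ineqs_solutions_output.
  by move=> s; exact: extreme_point_output.
- by move=> j; exact: in_dimjE.
- by move=> j i l; exact: in_phiE.
Qed.
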